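(* Let $d\ge1$, $\varepsilon>0$, $C\in\mathfrak S^+(d)$, let $\Gamma_q\subseteq\mathbb Z^d$ be a non-empty index set and $\{q_k\}_{k\in\Gamma_q}\subset\mathbb R^d$ an arbitrary grid such that $S(x):=\sum_{k\in\Gamma_q}|g_0(x-q_k)|^2<\infty$ for all $x\in\mathbb R^d$. For a Schwartz function $\psi\in\mathcal S(\mathbb R^d)$ and $q\in\mathbb R^d$ define $$\mathcal I_q(x):=(2\pi\varepsilon)^{-d}\int_{\mathbb R^d}\langle g_{(q,p)}\mid\psi\rangle\,g_{(q,p)}(x)\,dp,\qquad x\in\mathbb R^d.$$ Then, for all $x\in\mathbb R^d$, $$\psi(x)=\frac1{S(x)}\sum_{k\in\Gamma_q}\mathcal I_{q_k}(x)\qquad\text{and}\qquad \psi(x)=\int_{\mathbb R^d}\mathcal I_q(x)\,dq.$$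
   Context: $\mathfrak S^+(d)$ is the set of complex symmetric $d\times d$ matrices with positive definite imaginary part. For $z=(q,p)\in\mathbb R^{2d}$, $$g_z(x)=g_{(q,p)}(x)=(\pi\varepsilon)^{-d/4}\det(\operatorname{Im}C)^{1/4}\exp\left[\frac i\varepsilon\left(\frac12(x-q)^TC(x-q)+p^T(x-q)\right)\right],$$ and $g_0:=g_{(0,0)}$. The inner product is $\langle f\mid h\rangle=\int_{\mathbb R^d}\overline{f(x)}\,h(x)\,dx$. *)

(* Defs.v *)
From HB Require Import structures.
From mathcomp Require Import all_boot all_order all_algebra.
From mathcomp Require Import all_classical all_reals all_analysis.
From mathcomp Require Import complex.

Set Implicit Arguments.
Unset Strict Implicit.
Unset Printing Implicit Defensive.

Import Order.TTheory GRing.Theory Num.Theory.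
Import numFieldNormedType.Exports.

Local Open Scope classical_set_scope.
Local Open Scope ring_scope.

(* The library has product measures of two factors and a measurable structure
   on n.-tuple T, but no Lebesgue measure on R^n. It is built here on
   n.-tuple R by recursion, as the image of lebesgue_measure \x (measure on
   n.-tuple R) under (x, t) |-> x :: t. *)
Section lebesgue_tuple.
Variable R : realType.
Local Notation mR := (measurableTypeR R).

Definition tuple_cons n (u : mR * n.-tuple mR) : n.+1.-tuple mR :=
  [tuple of u.1 :: u.2].

Lemma measurable_tuple_cons n : measurable_fun setT (@tuple_cons n).
Proof.
apply: measurable_cons; [exact: measurable_fst|exact: measurable_snd].
Qed.

Section step.
Variables (n : nat) (m : {sigma_finite_measure set (n.-tuple mR) -> \bar R}).

Definition lebesgue_tuple_step : set (n.+1.-tuple mR) -> \bar R :=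
  pushforward ((@lebesgue_measure R) \x m)%E (@tuple_cons n).

Let step0 : lebesgue_tuple_step set0 = 0%E.
Proof. by rewrite /lebesgue_tuple_step /pushforward preimage_set0 measure0. Qed.

Let step_ge0 A : (0 <= lebesgue_tuple_step A)%E.
Proof. by rewrite /lebesgue_tuple_step /pushforward measure_ge0. Qed.

Let step_sigma_additive : semi_sigma_additive lebesgue_tuple_step.
Proof.
move=> F mF tF mUF; rewrite /lebesgue_tuple_step /pushforward preimage_bigcup.
have mcons A : measurable A -> measurable (@tuple_cons n @^-1` A).
  by move=> mA; rewrite -[X in measurable X]setTI; exact: measurable_tuple_cons.
apply: measure_semi_sigma_additive.
- by move=> k; exact: mcons.
- apply/trivIsetP => /= i j _ _ ij; rewrite -preimage_setI.
  by move/trivIsetP : tF => /(_ _ _ _ _ ij) ->//; rewrite preimage_set0.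
- by rewrite -preimage_bigcup; exact: mcons.
Qed.

HB.instance Definition _ := isMeasure.Build _ _ _
  lebesgue_tuple_step step0 step_ge0 step_sigma_additive.

Let step_sigma_finite : sigma_finite setT lebesgue_tuple_step.
Proof.
have /sigma_finiteP[F [TF ndF Foo]] := sigma_finiteT (@lebesgue_measure R).
have /sigma_finiteP[G [TG ndG Goo]] := sigma_finiteT m.
pose tl (t : n.+1.-tuple mR) : n.-tuple mR := [tuple of behead t].
have tlE u : tl (tuple_cons u) = u.2 by exact: val_inj.
pose H k : set (n.+1.-tuple mR) := [set t | F k (thead t) /\ G k (tl t)].
have HE k : @tuple_cons n @^-1` H k = F k `*` G k.
  by apply/seteqP; split => -[x t]; rewrite /H /= tlE.
exists H.
  apply/seteqP; split => // t _.
  have : [set: mR] (thead t) by [].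
  rewrite TF => -[k _ Fk].
  have : [set: n.-tuple mR] (tl t) by [].
  rewrite TG => -[l _ Gl].
  exists (maxn k l) => //; split.
    by move: Fk; exact/subsetPset/ndF/leq_maxl.
  by move: Gl; exact/subsetPset/ndG/leq_maxr.
move=> k; have [mF Fk] := Foo k; have [mG Gk] := Goo k; split.
  rewrite (_ : H k = ((@tnth n.+1 mR)^~ ord0 @^-1` F k) `&`
    (tl @^-1` G k))//.
  apply: measurableI; rewrite -[X in measurable X]setTI.
    exact: measurable_tnth.
  exact: measurable_behead.
rewrite /lebesgue_tuple_step /pushforward HE product_measure1E//.
by rewrite lte_mul_pinfty// ge0_fin_numE.
Qed.

HB.instance Definition _ := Measure_isSigmaFinite.Build _ _ _
  lebesgue_tuple_step step_sigma_finite.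

End step.

Fixpoint lebesgue_tuple (n : nat) :
    {sigma_finite_measure set (n.-tuple mR) -> \bar R} :=
  match n with
  | 0 => \d_([tuple])
  | k.+1 => lebesgue_tuple_step (lebesgue_tuple k)
  end.

Lemma lebesgue_tuple_box n (A : 'I_n -> set mR) :
  (forall i, measurable (A i)) ->
  lebesgue_tuple n [set t | forall i, A i (tnth t i)] =
  (\prod_(i < n) lebesgue_measure (A i))%E.
Proof.
elim: n A => [|n IH] A mA.
  rewrite big_ord0 /= diracE (_ : _ \in _)//.
  by rewrite inE => -[].
rewrite big_ord_recl /= /lebesgue_tuple_step /pushforward.
rewrite (_ : _ @^-1` _ = A ord0 `*` [set t | forall i : 'I_n, A (lift ord0 i) (tnth t i)]).
  rewrite product_measure1E//; first by congr (_ * _)%E; exact: IH.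
  rewrite (_ : [set t | _] =
    \bigcap_(i in [set: 'I_n]) ((@tnth n mR)^~ i @^-1` A (lift ord0 i))); last first.
    by apply/seteqP; split => t /= h i => [_|]; exact: h.
  apply: fin_bigcap_measurable; first exact: finite_finset.
  move=> i _; rewrite -[X in measurable X]setTI.
  exact: measurable_tnth.
apply/seteqP; split => -[x t] /= h.
  split; first by have := h ord0.
  by move=> i; have := h (lift ord0 i); rewrite tnthS.
move=> i; case: (unliftP ord0 i) => [j|] ->; last exact: h.1.
by rewrite tnthS; exact: h.2.
Qed.

End lebesgue_tuple.

Section complex_analysis.
Variable R : realType.
Local Notation RtoC := (real_complex R).

Definition modc : R[i] -> R := @ComplexField.Normc.normc R.

Definition cexp (z : R[i]) : R[i] :=
  Complex (expR (complex.Re z) * cos (complex.Im z))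
          (expR (complex.Re z) * sin (complex.Im z)).

Definition col_of_tuple d (t : d.-tuple (measurableTypeR R)) : 'cV[R]_d :=
  \col_i tnth t i.

(* Lebesgue integral over R^d of a complex function, by real and imaginary
   parts; as in the library it has a junk value when cintegrable fails. *)
Definition cintegrable d (f : 'cV[R]_d -> R[i]) : Prop :=
  (lebesgue_tuple R d).-integrable setT
    (fun t => (complex.Re (f (col_of_tuple t)))%:E) /\
  (lebesgue_tuple R d).-integrable setT
    (fun t => (complex.Im (f (col_of_tuple t)))%:E).

Definition cintegral d (f : 'cV[R]_d -> R[i]) : R[i] :=
  Complex (\int[lebesgue_tuple R d]_t complex.Re (f (col_of_tuple t)))
          (\int[lebesgue_tuple R d]_t complex.Im (f (col_of_tuple t))).

(* Unordered sums over an arbitrary index set; esum is meant for nonnegative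
   terms, hence the positive and negative parts. *)
Definition rsum (I : choiceType) (D : set I) (a : I -> R) : R :=
  fine (\esum_(k in D) (Num.max (a k) 0)%:E)
  - fine (\esum_(k in D) (Num.max (- a k) 0)%:E).

Definition csummable (I : choiceType) (D : set I) (a : I -> R[i]) : Prop :=
  (\esum_(k in D) (modc (a k))%:E < +oo)%E.

Definition csum (I : choiceType) (D : set I) (a : I -> R[i]) : R[i] :=
  Complex (rsum D (fun k => complex.Re (a k)))
          (rsum D (fun k => complex.Im (a k))).

Definition inner d (f h : 'cV[R]_d -> R[i]) : R[i] :=
  cintegral (fun x => conjc (f x) * h x).

Definition cpartial d (i : 'I_d) (f : 'cV[R]_d -> R[i]) (x : 'cV[R]_d) : R[i] :=
  Complex ('D_(delta_mx i 0) (fun y => complex.Re (f y)) x)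
          ('D_(delta_mx i 0) (fun y => complex.Im (f y)) x).

(* Iterated partial derivatives are indexed by words in the coordinates, so
   that equality of mixed partials is not built into the definition. *)
Definition cpartials d (s : seq 'I_d) (f : 'cV[R]_d -> R[i]) :
    'cV[R]_d -> R[i] :=
  foldr (@cpartial d) f s.

Definition smooth d (f : 'cV[R]_d -> R[i]) : Prop :=
  forall s : seq 'I_d,
    [/\ continuous (fun y => complex.Re (cpartials s f y)),
        continuous (fun y => complex.Im (cpartials s f y)) &
        forall (i : 'I_d) (x : 'cV[R]_d),
          derivable (fun y => complex.Re (cpartials s f y)) x (delta_mx i 0) /\
          derivable (fun y => complex.Im (cpartials s f y)) x (delta_mx i 0)].

Definition schwartz d (f : 'cV[R]_d -> R[i]) : Prop :=
  smooth f /\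
  forall (a : 'I_d -> nat) (s : seq 'I_d), exists M : R,
    forall x : 'cV[R]_d,
      `|\prod_i x i 0 ^+ a i| * modc (cpartials s f x) <= M.

Definition posdef d (A : 'M[R]_d) : Prop :=
  forall v : 'cV[R]_d, v != 0 -> 0 < (v^T *m A *m v) 0 0.

Definition siegel d (C : 'M[R[i]]_d) : Prop :=
  C^T = C /\ posdef (map_mx (@complex.Im R) C).

Definition gaussian d (eps : R) (C : 'M[R[i]]_d) (q p x : 'cV[R]_d) : R[i] :=
  RtoC ((pi * eps) `^ (- (d%:R / 4)) *
        (\det (map_mx (@complex.Im R) C)) `^ (1 / 4)) *
  cexp (Complex 0 1 / RtoC eps *
    (1 / 2 * ((map_mx RtoC (x - q))^T *m C *m map_mx RtoC (x - q)) 0 0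
     + RtoC ((p^T *m (x - q)) 0 0))).

Definition momentum_integrand d (eps : R) (C : 'M[R[i]]_d)
    (psi : 'cV[R]_d -> R[i]) (q x p : 'cV[R]_d) : R[i] :=
  inner (gaussian eps C q p) psi * gaussian eps C q p x.

Definition momentum_integral d (eps : R) (C : 'M[R[i]]_d)
    (psi : 'cV[R]_d -> R[i]) (q x : 'cV[R]_d) : R[i] :=
  RtoC ((2 * pi * eps) ^- d) * cintegral (momentum_integrand eps C psi q x).

Definition grid_sum d (eps : R) (C : 'M[R[i]]_d) (Gamma : set 'cV[int]_d)
    (qs : 'cV[int]_d -> 'cV[R]_d) (x : 'cV[R]_d) : \bar R :=
  (\esum_(k in Gamma) (modc (gaussian eps C 0 0 (x - qs k)) ^+ 2)%:E)%E.

End complex_analysis.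

(* Main.v *)
(* Write f = conj(g_(q,0)) psi.  The phases of <g_(q,p) | psi> and g_(q,p)(x)
   combine to exp(i p.(x - y) / eps), so that I_q(x) is g_(q,0)(x) times the
   inverse Fourier transform of the Fourier transform of f, taken at x, that
   is |g_0(x - q)|^2 psi(x).  Summing over the grid gives S(x) psi(x), and
   integrating over q gives psi(x) since |g_0|^2 has integral 1 (Gaussian
   integral, by induction on d with a Schur complement).

   Fourier inversion is obtained by Abel summation: the transform of f is
   multiplied by prod exp(- dl |p_i|), Fubini turns the integral into the
   convolution of f with a product of Poisson kernels, and dl tends to 0 on
   both sides by dominated convergence.  The transform of f is integrable
   because (1 + p_1^2) ... (1 + p_d^2) times it is the transform of
   (1 - d_1^2) ... (1 - d_d^2) f. *)

Require Import Defs.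
From HB Require Import structures.
From mathcomp Require Import all_boot all_order all_algebra.
From mathcomp Require Import all_classical all_reals all_analysis.
From mathcomp Require Import measurable_realfun complex ring lra.
Import Order.TTheory GRing.Theory Num.Theory.
Import numFieldNormedType.Exports.
Local Open Scope classical_set_scope.
Local Open Scope ring_scope.
Set Implicit Arguments.
Unset Strict Implicit.
Unset Printing Implicit Defensive.

(** * Lebesgue measure on tuples *)

(** One function, the Cauchy weight prod 1 / (1 + y_i^2), does most of the domination: it majorises
    the functions to be transformed as well as their transforms, and the Poisson kernel of width
    [dl] is, up to a constant, a rescaling of it. Substituting moves [dl] from the kernel into the
    argument of a bounded function, which makes the limit elementary. The exponential regulariser is
    chosen because it factors over the coordinates and its product with a cosine has an explicit
    antiderivative.

    All integrals are real. A free phase inside a cosine replaces the complex exponential: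
    differentiation and multiplication by i become shifts by pi / 2, and the addition formula of cos
    replaces the multiplicativity of exp.

    Decay of the transform costs 2 d derivatives of f, a product of three factors. Instead of a
    Leibniz formula, the inversion theorem is proved for any class of functions closed under partial
    derivatives and differences; the class used is generated by exp (- be) cos (al + phi) w, with al
    and be quadratic and w a real or imaginary part of a derivative of psi. *)

Section affine1.
Variable R : realType.
Local Notation mR := (measurableTypeR R).
Local Notation mu := (@lebesgue_measure R).

Definition affine1 (m c : R) : mR -> mR := fun x => m + c * x.

Lemma measurable_affine1 (m c : R) : measurable_fun [set: mR] (affine1 m c).
Proof. by apply: measurable_funD => //; apply: measurable_funM. Qed.

HB.instance Definition _ m c :=
  isMeasurableFun.Build _ _ _ _ (affine1 m c) (measurable_affine1 m c).

Lemma preimage_affine1 (m c a b : R) : 0 < c ->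
  affine1 m c @^-1` `]a, b] = `](a - m) / c, (b - m) / c]%classic.
Proof.
move=> c0; apply/seteqP; split => x /=; rewrite !in_itv/= /affine1;
  by rewrite ltr_pdivrMr// ler_pdivlMr// ltrBlDl lerBrDl mulrC.
Qed.

(** By uniqueness of Lebesgue measure it suffices to compare both sides on half-open intervals,
    where the preimage has length (b - a) / c. *)
Lemma lebesgue_measure_affine1 (m c : R) (A : set mR) : 0 < c ->
  measurable A ->
  mu A = (c%:E * pushforward mu (affine1 m c) A)%E.
Proof.
move=> c0 mA; pose k : {nonneg R} := NngNum (ltW c0).
rewrite (_ : (_ * _)%E = mscale k (pushforward mu (affine1 m c)) A)//.
apply: (lebesgue_measure_unique (mu := mscale k (pushforward mu (affine1 m c)))) => // X /ocitvP[->|[[a b] /= ab ->]].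
  by rewrite !measure0.
rewrite /mscale/= /pushforward preimage_affine1//.
rewrite !lebesgue_measure_itv/= !lte_fin ab ltr_pM2r ?invr_gt0// ltrD2r ab.
rewrite -!EFinD -EFinM; congr EFin; field; exact: lt0r_neq0.
Qed.

Lemma ge0_integral_affine1 (m c : R) (f : mR -> \bar R) : 0 < c ->
  measurable_fun setT f -> (forall x, (0 <= f x)%E) ->
  (\int[mu]_x f x = c%:E * \int[mu]_x f (m + c * x)%R)%E.
Proof.
move=> c0 mf f0; pose k : {nonneg R} := NngNum (ltW c0).
rewrite (eq_measure_integral (mscale k (pushforward mu (affine1 m c)))).
  rewrite ge0_integral_mscale//=; congr (_ * _)%E.
  by rewrite ge0_integral_pushforward//= ?preimage_setT//.
by move=> A mA _; exact: lebesgue_measure_affine1.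
Qed.

End affine1.

Section tuple_integral.
Variable R : realType.
Local Notation mR := (measurableTypeR R).
Local Notation mu := (@lebesgue_measure R).
Local Notation lam := (lebesgue_tuple R).

Lemma ge0_integral_tuple_cons n (f : n.+1.-tuple mR -> \bar R) :
  measurable_fun setT f -> (forall t, (0 <= f t)%E) ->
  (\int[lam n.+1]_t f t =
   \int[mu \x lam n]_u f (tuple_cons u))%E.
Proof.
move=> mf f0.
have mc := @measurable_tuple_cons R n.
by rewrite -[RHS]/(\int[_]_(u in @tuple_cons R n @^-1` setT) (f \o @tuple_cons R n) u)%E
  -ge0_integral_pushforward.
Qed.

Lemma ge0_integral_tupleS n (f : n.+1.-tuple mR -> \bar R) :
  measurable_fun setT f -> (forall t, (0 <= f t)%E) ->
  (\int[lam n.+1]_t f t =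
   \int[mu]_x \int[lam n]_t f (tuple_cons (x, t)))%E.
Proof.
move=> mf f0; rewrite ge0_integral_tuple_cons// fubini_tonelli1//.
exact: measurableT_comp (@measurable_tuple_cons R n).
Qed.

(** With the first coordinate innermost, completing the square can eliminate it first in the
    Gaussian integral. *)
Lemma ge0_integral_tupleS_swap n (f : n.+1.-tuple mR -> \bar R) :
  measurable_fun setT f -> (forall t, (0 <= f t)%E) ->
  (\int[lam n.+1]_t f t =
   \int[lam n]_t \int[mu]_x f (tuple_cons (x, t)))%E.
Proof.
move=> mf f0; rewrite ge0_integral_tuple_cons// fubini_tonelli2//.
exact: measurableT_comp (@measurable_tuple_cons R n).
Qed.

Definition affine n (m : 'I_n -> R) (c : R) (t : n.-tuple mR) : n.-tuple mR :=
  [tuple m i + c * tnth t i | i < n].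

Lemma measurable_affine n (m : 'I_n -> R) c : measurable_fun setT (affine m c).
Proof.
apply/measurable_fun_tnthP => i.
rewrite (_ : _ \o _ = affine1 (m i) c \o (@tnth n mR)^~ i); last first.
  by apply/funext => t /=; rewrite tnth_mktuple.
exact: measurableT_comp (measurable_affine1 _ _) (measurable_tnth i).
Qed.

Lemma affine_tuple_cons n (m : 'I_n.+1 -> R) c x (t : n.-tuple mR) :
  affine m c (tuple_cons (x, t)) =
  tuple_cons (affine1 (m ord0) c x, affine (fun i => m (lift ord0 i)) c t).
Proof.
apply: eq_from_tnth => i; rewrite tnth_mktuple.
by case: (unliftP ord0 i) => [j|] -> //; rewrite !tnthS tnth_mktuple.
Qed.

Lemma measurable_tuple_cons1 n (x : mR) :
  measurable_fun setT (fun t : n.-tuple mR => tuple_cons (x, t)).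
Proof. exact: measurableT_comp (@measurable_tuple_cons R n) _. Qed.

(** Translations and homotheties cover every substitution made below: shifts by a point, dilations
    by [dl] and by [eps]. Each coordinate contributes one factor [c]. *)
Lemma ge0_integral_affine n (m : 'I_n -> R) (c : R)
    (f : n.-tuple mR -> \bar R) : 0 < c ->
  measurable_fun setT f -> (forall t, (0 <= f t)%E) ->
  (\int[lam n]_t f t = (c ^+ n)%:E * \int[lam n]_t f (affine m c t))%E.
Proof.
move=> c0; elim: n m f => [|n IH] m f mf f0.
  rewrite expr0 mul1e; apply: eq_integral => t _.
  by congr f; apply: eq_from_tnth => -[].
have mfa : measurable_fun setT (f \o affine m c).
  exact: measurableT_comp mf (measurable_affine _ _).
rewrite ge0_integral_tupleS// [in RHS]ge0_integral_tupleS//.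
pose F x := (\int[lam n]_t f (tuple_cons (x, t)))%E.
have mF : measurable_fun setT F.
  apply: (measurable_fun_fubini_tonelli_F (f \o @tuple_cons R n)).
    exact: measurableT_comp mf (@measurable_tuple_cons R n).
  by move=> u; exact: f0.
have F0 x : (0 <= F x)%E by exact: integral_ge0.
rewrite (ge0_integral_affine1 (m ord0) c0 mF F0) exprS EFinM -muleA; congr (_ * _)%E.
rewrite -ge0_integralZl//=; first last.
- by rewrite lee_fin exprn_ge0// ltW.
- by move=> x _; exact: integral_ge0.
- apply: (measurable_fun_fubini_tonelli_F (f \o affine m c \o @tuple_cons R n)).
    exact: measurableT_comp mfa (@measurable_tuple_cons R n).
  by move=> u; exact: f0.
apply: eq_integral => x _; rewrite /F.
rewrite (IH (fun i => m (lift ord0 i))) //; last first.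
  exact: measurableT_comp mf (measurable_tuple_cons1 _).
congr (_ * _)%E; apply: eq_integral => t _.
by rewrite affine_tuple_cons.
Qed.

Lemma integrable_affine n (m : 'I_n -> R) (c : R)
    (f : n.-tuple mR -> \bar R) : 0 < c ->
  (lam n).-integrable setT f ->
  (lam n).-integrable setT (f \o affine m c).
Proof.
move=> c0 /integrableP[mf foo].
have mfa := measurableT_comp mf (measurable_affine m c).
apply/integrableP; split => //.
(* Finiteness is unaffected by the positive factor [c ^+ n], which is exactly the Jacobian. *)
rewrite -(@lte_pmul2l _ (c ^+ n)%:E)// ?lte_fin ?exprn_gt0//.
rewrite -[X in (X < _)%E](ge0_integral_affine m c0 (f := abse \o f)).
- by rewrite gt0_muley// lte_fin exprn_gt0.
- exact: measurableT_comp.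
- by move=> t /=.
Qed.

Lemma Rintegral_affine n (m : 'I_n -> R) (c : R) (f : n.-tuple mR -> R) :
  0 < c -> (lam n).-integrable setT (EFin \o f) ->
  \int[lam n]_t f t = c ^+ n * \int[lam n]_t f (affine m c t).
Proof.
move=> c0 fi; have fai := integrable_affine m c0 fi.
have mf := measurable_int _ fi.
rewrite -RintegralZl// /Rintegral; congr fine.
under [RHS]eq_integral do rewrite EFinM.
rewrite integralZl//.
rewrite integralE [X in _ = (_ * X)%E]integralE.
rewrite (ge0_integral_affine m c0 (measurable_funepos mf))//.
rewrite (ge0_integral_affine m c0 (measurable_funeneg mf))//.
rewrite -muleBr//.
  by congr (_ * (_ - _))%E; apply: eq_integral => t _; rewrite !unlock.
by have := integrable_add_def measurableT fai; rewrite funepos_comp funeneg_comp.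
Qed.

Lemma ge0_integral_prod_tuple n (w : mR -> R) :
  measurable_fun setT w -> (forall x, 0 <= w x) ->
  (\int[mu]_x (w x)%:E < +oo)%E ->
  (\int[lam n]_t (\prod_(i < n) w (tnth t i))%:E =
   ((\int[mu]_x w x) ^+ n)%:E)%E.
Proof.
move=> mw w0 woo; elim: n => [|n IH].
  under eq_integral do rewrite big_ord0.
  by rewrite integral_cst//= expr0 mul1e diracT.
have mp k : measurable_fun setT (fun t : k.-tuple mR => \prod_(i < k) w (tnth t i)).
  apply: measurable_prod => i _.
  exact: measurableT_comp mw (measurable_tnth i).
rewrite ge0_integral_tupleS//; first last.
- by move=> t; rewrite lee_fin prodr_ge0.
- by apply/measurable_EFinP; apply: mp.
have E x (t : n.-tuple mR) : \prod_(i < n.+1) w (tnth (tuple_cons (x, t)) i) =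
    w x * \prod_(i < n) w (tnth t i).
  by rewrite big_ord_recl; congr (_ * _); apply: eq_bigr => i _; rewrite tnthS.
under eq_integral => x _.
  under eq_integral do rewrite E EFinM.
  rewrite ge0_integralZl//=; first last.
  - by rewrite lee_fin.
  - by move=> t _; rewrite lee_fin prodr_ge0.
  - by apply/measurable_EFinP; apply: mp.
  rewrite IH muleC; over.
rewrite ge0_integralZl//=; first last.
- by rewrite lee_fin exprn_ge0// Rintegral_ge0.
- by move=> x _; rewrite lee_fin.
- exact/measurable_EFinP.
rewrite exprSr EFinM; congr (_ * _)%E.
by rewrite /Rintegral fineK// ge0_fin_numE//; apply: integral_ge0 => x _; rewrite lee_fin.
Qed.

Lemma integrable_prod_tuple n (w : mR -> R) :
  measurable_fun setT w -> (forall x, 0 <= w x) ->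
  (\int[mu]_x (w x)%:E < +oo)%E ->
  (lam n).-integrable setT (fun t => (\prod_(i < n) w (tnth t i))%:E).
Proof.
move=> mw w0 woo; apply/integrableP; split.
  apply/measurable_EFinP; apply: measurable_prod => i _.
  exact: measurableT_comp mw (measurable_tnth i).
under eq_integral do rewrite gee0_abs ?lee_fin ?prodr_ge0//.
by rewrite ge0_integral_prod_tuple// ltry.
Qed.

End tuple_integral.

(** * One-dimensional integrals *)

Section integrals1.
Variable R : realType.
Local Notation mR := (measurableTypeR R).
Local Notation mu := (@lebesgue_measure R).

Lemma ge0_integral_derive_y (f F : R -> R) (l : R) :
  (forall x, 0 <= f x) -> continuous f ->
  (forall x : R, is_derive x 1 F (f x)) -> F x @[x --> +oo] --> l ->
  (\int[mu]_(x in `[0%R, +oo[) (f x)%:E = (l - F 0)%:E)%E.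
Proof.
move=> f0 cf dF Fl.
rewrite (@ge0_continuous_FTC2y _ f F 0 l)//.
- by apply: continuous_subspaceT.
- apply: cvg_at_right_filter.
  by apply/differentiable_continuous/derivable1_diffP.
- by move=> x _; rewrite derive1E derive_val.
Qed.

Lemma ge0_integralT_split (f : R -> R) : (forall x, 0 <= f x) -> continuous f ->
  (\int[mu]_x (f x)%:E = \int[mu]_(x in `[0%R, +oo[) (f x)%:E +
    \int[mu]_(x in `[0%R, +oo[) (f (- x))%:E)%E.
Proof.
move=> f0 cf; have mf : measurable_fun setT f by exact: continuous_measurable_fun.
have -> : [set: R] = `]-oo, 0%R] `|` `]0%R, +oo[.
  by rewrite -(@itv_bndbnd_setU _ _ -oo%O (BRight 0%R) +oo%O)// set_itvNyy.
rewrite ge0_integral_setU//=; first last.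
- apply/disj_setPS => x [/=]; rewrite !in_itv/= andbT => x0.
  by rewrite ltNge x0.
- by move=> x _; rewrite lee_fin.
- exact/measurable_EFinP/measurable_funTS.
rewrite addeC integral_itv_obnd_cbnd; last exact/measurable_EFinP/measurable_funTS.
congr (_ + _)%E; rewrite -{1}oppr0 ge0_integration_by_substitutionNy//.
by apply: continuous_subspaceT.
Qed.

Lemma integral_cauchy : (\int[mu]_x ((1 + x ^+ 2)^-1)%:E = pi%:E)%E.
Proof.
have p0 (x : R) : 0 < 1 + x ^+ 2 by rewrite ltr_pwDl// sqr_ge0.
have c : continuous (fun x : R => (1 + x ^+ 2)^-1).
  move=> x; apply: cvgV; first exact: lt0r_neq0.
  by apply: cvgD; [exact: cvg_cst|exact: exprn_continuous].
have g0 (x : R) : 0 <= (1 + x ^+ 2)^-1 by rewrite invr_ge0 ltW.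
rewrite ge0_integralT_split//.
under [X in (_ + X)%E]eq_integral do rewrite sqrrN.
rewrite (@ge0_integral_derive_y _ (@atan R) (pi / 2))//; last exact: cvgy_atan.
by rewrite atan0 subr0 -EFinD; congr EFin; lra.
Qed.

Lemma cvg_expRM_bounded (dl : R) (b : R -> R) (M : R) : 0 < dl ->
  (forall x, `|b x| <= M) -> expR (- (dl * x)) * b x @[x --> +oo] --> 0.
Proof.
move=> dl0 bM.
have h : M * expR (- (dl * x)) @[x --> +oo] --> 0.
  rewrite -(mulr0 M); apply: cvgMr.
  apply: (cvg_comp (fun x => dl * x) (fun y => expR (- y))); last exact: cvgr_expR.
  by apply: gt0_cvgMry => //; exact: cvg_id.
apply: (@squeeze_cvgr _ _ _ _ (fun x => - (M * expR (- (dl * x)))) (fun x => M * expR (- (dl * x)))) => //.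
- apply: nearW => x; rewrite -ler_norml normrM (ger0_norm (expR_ge0 _)) mulrC.
  by rewrite ler_wpM2r ?expR_ge0.
- by rewrite -oppr0; exact: cvgN.
Qed.

(** The added 1 makes the integrand nonnegative, so the fundamental theorem of calculus on a half
    line applies without a separate integrability argument. *)
Lemma integral0y_expR_cos (dl s phi : R) : 0 < dl ->
  (\int[mu]_(x in `[0%R, +oo[) (expR (- (dl * x)) * (1 + cos (x * s + phi)))%:E =
   (dl^-1 + (dl * cos phi - s * sin phi) / (dl ^+ 2 + s ^+ 2))%:E)%E.
Proof.
move=> dl0; have D0 : 0 < dl ^+ 2 + s ^+ 2 by rewrite ltr_pwDl ?sqr_ge0 ?exprn_gt0.
(* [expR (- (dl * x)) * b x] is the antiderivative; [b] is bounded, so it vanishes at infinity. *)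
pose b x := - dl^-1 + (s * sin (x * s + phi) - dl * cos (x * s + phi)) / (dl ^+ 2 + s ^+ 2).
have dF (x : R) : is_derive x 1 (fun x => expR (- (dl * x)) * b x)
    (expR (- (dl * x)) * (1 + cos (x * s + phi))).
  rewrite /b; apply: is_derive_eq.
  by rewrite /GRing.scale/=; field; rewrite (gt_eqF dl0)/= gt_eqF.
rewrite (ge0_integral_derive_y (l := 0) _ _ dF); first last.
- apply: (@cvg_expRM_bounded _ _ (dl^-1 + (`|s| + dl) / (dl ^+ 2 + s ^+ 2))) => // x.
  rewrite (le_trans (ler_normD _ _))// normrN gtr0_norm ?invr_gt0// lerD2l.
  rewrite normrM (gtr0_norm (x := _^-1)) ?invr_gt0// ler_pM2r ?invr_gt0//.
  rewrite (le_trans (ler_normB _ _))// !normrM (gtr0_norm dl0) lerD//.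
    by rewrite ler_piMr// ler_norml sin_geN1 sin_le1.
  by rewrite ler_piMr ?(ltW dl0)// ler_norml cos_geN1 cos_le1.
- move=> x; apply: cvgM.
    apply: continuous_comp; last exact: continuous_expR.
    by apply: cvgN; apply: cvgM; [exact: cvg_cst|exact: cvg_id].
  apply: cvgD; first exact: cvg_cst.
  apply: continuous_comp; last exact: continuous_cos.
  by apply: cvgD; [apply: cvgM; [exact: cvg_id|exact: cvg_cst]|exact: cvg_cst].
- move=> x; apply: mulr_ge0; first exact: expR_ge0.
  by have := cos_geN1 (x * s + phi); lra.
congr EFin; rewrite /b mulr0 oppr0 expR0 mul0r mul1r !add0r.
by field; rewrite (gt_eqF dl0)/= gt_eqF.
Qed.

Definition abel (dl x : R) : R := expR (- (dl * `|x|)).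

Lemma abel_ge0 dl x : 0 <= abel dl x. Proof. exact: expR_ge0. Qed.

Lemma continuous_abel dl : continuous (abel dl).
Proof.
move=> x; apply: continuous_comp; last exact: continuous_expR.
by apply: cvgN; apply: cvgM; [exact: cvg_cst|exact: norm_continuous].
Qed.

Lemma measurable_abel dl : measurable_fun [set: mR] (abel dl).
Proof. by apply: (@continuous_measurable_fun R); exact: continuous_abel. Qed.

Lemma continuous_cos_affine (s phi : R) : continuous (fun x : R => cos (x * s + phi)).
Proof.
move=> x; apply: continuous_comp; last exact: continuous_cos.
by apply: cvgD; [apply: cvgM; [exact: cvg_id|exact: cvg_cst]|exact: cvg_cst].
Qed.

(** Reflecting the negative half line changes the sign of [s], so the sine terms cancel and the
    cosine terms double. *)
Lemma integral_abel_cos1 (dl s phi : R) : 0 < dl ->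
  (\int[mu]_x (abel dl x * (1 + cos (x * s + phi)))%:E =
   (2 / dl + 2 * dl * cos phi / (dl ^+ 2 + s ^+ 2))%:E)%E.
Proof.
move=> dl0; have D0 : 0 < dl ^+ 2 + s ^+ 2 by rewrite ltr_pwDl ?sqr_ge0 ?exprn_gt0.
rewrite ge0_integralT_split; first last.
- move=> x; apply: cvgM; first exact: continuous_abel.
  by apply: cvgD; [exact: cvg_cst|exact: continuous_cos_affine].
- move=> x; apply: mulr_ge0; first exact: abel_ge0.
  by have := cos_geN1 (x * s + phi); lra.
have E (x : R) : x \in `[0%R, +oo[%classic -> `|x| = x.
  by rewrite inE/= in_itv/= andbT => /ger0_norm.
under eq_integral => x x0 do rewrite /abel (E _ x0).
under [X in (_ + X)%E]eq_integral => x x0 do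
  rewrite /abel normrN (E _ x0) mulNr -mulrN.
rewrite !integral0y_expR_cos// -EFinD sqrrN; congr EFin.
by field; rewrite (gt_eqF dl0)/= gt_eqF.
Qed.

(** For s = phi = 0 the factor 1 + cos is the constant 2. *)
Lemma integral_abel (dl : R) : 0 < dl ->
  (\int[mu]_x (abel dl x)%:E = (2 / dl)%:E)%E.
Proof.
move=> dl0; have := @integral_abel_cos1 dl 0 0 dl0.
under eq_integral do rewrite mulr0 add0r cos0 EFinM muleC.
rewrite ge0_integralZl//=; last 2 first.
- by apply/measurable_EFinP; exact: measurable_abel.
- by move=> x _; rewrite lee_fin abel_ge0.
rewrite cos0 => /(congr1 (fun x => (2^-1)%:E * x)%E).
rewrite muleA -EFinM (_ : 2^-1 * (1 + 1) = 1) ?mul1e; last lra.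
move=> ->; rewrite -EFinM; congr EFin; field; exact: lt0r_neq0.
Qed.

Lemma integrable_abel (dl : R) : 0 < dl -> mu.-integrable setT (EFin \o abel dl).
Proof.
move=> dl0; apply/integrableP; split; first by apply/measurable_EFinP; exact: measurable_abel.
under eq_integral do rewrite gee0_abs ?lee_fin ?abel_ge0//.
by rewrite integral_abel// ltry.
Qed.

Lemma integrable_abel_cos (dl s phi : R) : 0 < dl ->
  mu.-integrable setT (fun x => (abel dl x * cos (x * s + phi))%:E).
Proof.
move=> dl0; apply: le_integrable (integrable_abel dl0) => //.
  apply/measurable_EFinP/measurable_funM; first exact: measurable_abel.
  by apply: (@continuous_measurable_fun R); exact: continuous_cos_affine.
move=> x _; rewrite lee_fin /= normrM (ger0_norm (abel_ge0 _ _)).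
by rewrite ler_piMr ?abel_ge0// ler_norml cos_geN1 cos_le1.
Qed.

(** Subtracting [integral_abel] removes the auxiliary 1. Up to the factor 2 pi, the Poisson kernel
    of the half plane remains. *)
Lemma integral_abel_cos (dl s phi : R) : 0 < dl ->
  (\int[mu]_x (abel dl x * cos (x * s + phi))%:E =
   (cos phi * (2 * dl / (dl ^+ 2 + s ^+ 2)))%:E)%E.
Proof.
move=> dl0; have := @integral_abel_cos1 dl s phi dl0.
under eq_integral do rewrite mulrDr mulr1.
rewrite integralD_EFin//; [|exact: integrable_abel|exact: integrable_abel_cos].
rewrite integral_abel//; case: integral => [r| |] //= [/addrI ->]; congr EFin.
by rewrite mulrAC mulrC.
Qed.

End integrals1.

(** * Signed integrals over tuples and products of Abel factors *)

Section tuple_integral_signed.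
Variable R : realType.
Local Notation mR := (measurableTypeR R).
Local Notation mu := (@lebesgue_measure R).
Local Notation lam := (lebesgue_tuple R).

Lemma integral_tupleS n (f : n.+1.-tuple mR -> \bar R) :
  (lam n.+1).-integrable setT f ->
  (\int[lam n.+1]_t f t =
   \int[mu]_x \int[lam n]_t f (tuple_cons (x, t)))%E.
Proof.
move=> fi; have /integrableP[mf foo] := fi.
have mc := @measurable_tuple_cons R n.
have mfc := measurableT_comp mf mc.
have fci : (mu \x lam n)%E.-integrable setT (f \o @tuple_cons R n).
  apply/integrableP; split => //.
  rewrite -(ge0_integral_tuple_cons (f := abse \o f)) => [//||t].
    exact: measurableT_comp.
  exact: abse_ge0.
have := integral_pushforward mc mf fci measurableT; rewrite preimage_setT => ->.
by rewrite -integral12_prod_meas1.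
Qed.

Lemma normr_cos_le1 (x : R) : `|cos x| <= 1.
Proof. by rewrite ler_norml cos_geN1 cos_le1. Qed.

Lemma measurable_sum_tnth n (s : 'I_n -> R) :
  measurable_fun setT (fun t : n.-tuple mR => \sum_(i < n) tnth t i * s i).
Proof.
apply: measurable_sum => i; apply: measurable_funM => //.
exact: measurable_tnth.
Qed.

Lemma measurable_cos_phase n (s : 'I_n -> R) (phi : R) :
  measurable_fun setT
    (fun t : n.-tuple mR => cos (phi + \sum_(i < n) tnth t i * s i)).
Proof.
apply: measurableT_comp; first by apply: (@continuous_measurable_fun R); exact: continuous_cos.
by apply: measurable_funD => //; exact: measurable_sum_tnth.
Qed.

Lemma measurable_prod_abel n (dl : R) :
  measurable_fun setT (fun t : n.-tuple mR => \prod_(i < n) abel dl (tnth t i)).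
Proof.
apply: measurable_prod => i _.
exact: measurableT_comp (@measurable_abel R dl) (measurable_tnth i).
Qed.

Lemma integrable_prod_abel n (dl : R) : 0 < dl ->
  (lam n).-integrable setT
    (fun t => (\prod_(i < n) abel dl (tnth t i))%:E).
Proof.
move=> dl0; apply: integrable_prod_tuple; first exact: measurable_abel.
  by move=> x; exact: abel_ge0.
by rewrite integral_abel// ltry.
Qed.

Lemma integrable_prod_abel_cos n (dl : R) (s : 'I_n -> R) phi : 0 < dl ->
  (lam n).-integrable setT (fun t =>
    (\prod_(i < n) abel dl (tnth t i) * cos (phi + \sum_(i < n) tnth t i * s i))%:E).
Proof.
move=> dl0; apply: le_integrable (integrable_prod_abel n dl0) => //.
  apply/measurable_EFinP; apply: measurable_funM; first exact: measurable_prod_abel.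
  exact: measurable_cos_phase.
by move=> t _; rewrite lee_fin /= normrM ler_piMr// normr_cos_le1.
Qed.

(** The induction closes because [phi] is arbitrary: for a fixed first coordinate [x], the term
    [x * s ord0] is absorbed into the phase of the remaining ones. *)
Lemma integral_prod_abel_cos n (dl : R) (s : 'I_n -> R) phi : 0 < dl ->
  (\int[lam n]_t
    (\prod_(i < n) abel dl (tnth t i) * cos (phi + \sum_(i < n) tnth t i * s i))%:E =
   (cos phi * \prod_(i < n) (2 * dl / (dl ^+ 2 + s i ^+ 2)))%:E)%E.
Proof.
move=> dl0; elim: n s phi => [|n IH] s phi.
  under eq_integral do rewrite !big_ord0 addr0 mul1r.
  by rewrite integral_cst//= big_ord0 mulr1 diracT mule1.
rewrite integral_tupleS; last exact: integrable_prod_abel_cos.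
have E x (t : n.-tuple mR) :
    \prod_(i < n.+1) abel dl (tnth (tuple_cons (x, t)) i) *
      cos (phi + \sum_(i < n.+1) tnth (tuple_cons (x, t)) i * s i) =
    abel dl x * (\prod_(i < n) abel dl (tnth t i) *
      cos (phi + x * s ord0 + \sum_(i < n) tnth t i * s (lift ord0 i))).
  rewrite !big_ord_recl -mulrA; congr (_ * _); congr (_ * _).
    by apply: eq_bigr => i _; rewrite tnthS.
  rewrite addrA; congr (cos (_ + _)).
  by apply: eq_bigr => i _; rewrite tnthS.
under eq_integral => x _.
  under eq_integral do rewrite E EFinM.
  rewrite integralZl//; last exact: integrable_prod_abel_cos.
  rewrite IH -EFinM mulrA EFinM muleC; over.
rewrite /= integralZl//; last first.
  by under eq_fun do rewrite addrC; exact: integrable_abel_cos.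
under eq_integral do rewrite [phi + _]addrC.
rewrite integral_abel_cos// big_ord_recl -EFinM; congr EFin.
by rewrite mulrCA; congr (_ * _); exact: mulrC.
Qed.

End tuple_integral_signed.

(** * Measurability on tuples of continuous functions of columns *)

Section column_continuity.
Variables (R : realType) (d : nat).
Local Notation mR := (measurableTypeR R).

Lemma cvg_col (T : Type) (F : set_system T) (FF : Filter F)
    (f : T -> 'cV[R]_d) (x : 'cV[R]_d) :
  (forall i, f t i 0 @[t --> F] --> x i 0) -> f t @[t --> F] --> x.
Proof.
move=> fx A [P Px PA].
have : \forall t \near F, forall i, P i 0 (f t i 0).
  by apply: filter_forall => i; exact: (fx i (P i 0) (Px i 0)).
by apply: filterS => t Pt; apply: PA => i j; rewrite ord1.
Qed.

Lemma continuous_col (T : topologicalType) (f : T -> 'cV[R]_d) :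
  (forall i, continuous (fun t => f t i 0)) -> continuous f.
Proof. by move=> cf t; apply: cvg_col => i; exact: cf. Qed.

Lemma col_of_tupleE (t : d.-tuple mR) i : col_of_tuple t i 0 = tnth t i.
Proof. by rewrite mxE. Qed.

(** Rounding down to the grid of mesh 1 / (N + 1) leaves countably many values, so any function of
    the rounded point is measurable. *)
Definition grid_index (N : nat) (t : d.-tuple mR) : 'cV[int]_d :=
  \col_i Num.floor (N.+1%:R * tnth t i : R).

Definition grid_point (N : nat) (k : 'cV[int]_d) : 'cV[R]_d :=
  \col_i ((k i 0)%:~R / N.+1%:R).

Lemma cvg_grid_point (t : d.-tuple mR) :
  grid_point N (grid_index N t) @[N --> \oo] --> col_of_tuple t.
Proof.
apply: cvg_col => i; apply/cvgrPdist_le => e e0.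
have := @near_infty_natSinv_lt R (PosNum e0); apply: filterS => N /= Ne.
have N0 : 0 < N.+1%:R :> R by [].
rewrite !mxE; set a := tnth t i.
have h1 : (Num.floor (N.+1%:R * a))%:~R <= N.+1%:R * a by exact: floor_le_tmp.
have h2 : N.+1%:R * a < (Num.floor (N.+1%:R * a) + 1)%:~R by exact: floorD1_gt.
have -> : a - (Num.floor (N.+1%:R * a))%:~R / N.+1%:R =
    (N.+1%:R * a - (Num.floor (N.+1%:R * a))%:~R) / N.+1%:R :> R.
  by field; exact: lt0r_neq0.
rewrite normrM (ger0_norm (x := _^-1)) ?invr_ge0//.
apply: le_trans (ltW Ne); rewrite ler_piMl ?invr_ge0//.
rewrite intrD mulr1z in h2.
by rewrite ger0_norm; lra.
Qed.

(** Indices are countable, so [A] may be arbitrary: its preimage is a countable union of cells, each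
    a finite intersection of conditions that a scaled coordinate lies in a half-open unit
    interval. *)
Lemma measurable_grid_index N (A : set 'cV[int]_d) :
  measurable (grid_index N @^-1` A).
Proof.
rewrite (_ : _ @^-1` _ =
    \bigcup_k (grid_index N @^-1` [set k] `&` [set _ | A k])); last first.
  apply/seteqP; split => t /=; first by move=> At; exists (grid_index N t).
  by move=> [k _ [/= ->]].
apply: countable_bigcupT_measurable => [//|k].
apply: measurableI; last first.
  by have [Ak|nAk] := pselect (A k); [rewrite (_ : [set _ | _] = setT)|rewrite (_ : [set _ | _] = set0)]
    => //; apply/seteqP; split.
rewrite (_ : _ @^-1` _ = \bigcap_(i in [set: 'I_d])
    ((fun t : d.-tuple mR => N.+1%:R * tnth t i : mR) @^-1`
      `[(k i 0)%:~R, (k i 0 + 1)%:~R[)); last first.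
  apply/seteqP; split => t /=.
    by move=> <- i _ /=; rewrite mxE in_itv/= floor_itv.
  move=> h; apply/colP => i; rewrite mxE; apply: floor_def.
  by have := h i I; rewrite /= in_itv.
apply: fin_bigcap_measurable; first exact: finite_finset.
move=> i _; rewrite -[X in measurable X]setTI.
have mh : measurable_fun setT (fun t : d.-tuple mR => N.+1%:R * tnth t i : mR).
  by apply: measurable_funM => //; exact: measurable_tnth.
exact: mh.
Qed.

(** By continuity [f] is the pointwise limit of its values at the rounded points. *)
Lemma measurable_col (f : 'cV[R]_d -> R) : continuous f ->
  measurable_fun setT (fun t => f (col_of_tuple t)).
Proof.
move=> cf; apply: (measurable_fun_cvg
    (h := fun N t => f (grid_point N (grid_index N t)))) => [N _ B mB|t _].
  rewrite setTI -[X in measurable X]/(grid_index N @^-1` (fun k => B (f (grid_point N k)))).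
  exact: measurable_grid_index.
by apply: continuous_cvg; [exact: cf|exact: cvg_grid_point].
Qed.

End column_continuity.

(** * Fourier inversion *)

Section directional.
Variables (R : realType) (V : normedModType R).

(** Restriction to a line makes the one-variable derivative rules and the mean value theorem
    available for directional derivatives. *)
Lemma is_derive_lineP (f : V -> R) (y v : V) (t l : R) :
  is_derive t (1 : R) (fun s : R => f (y + s *: v)) l <->
  is_derive (y + t *: v) v f l.
Proof.
pose F (s : R) := f (y + s *: v); rewrite -/F.
have E (h : R) : h^-1 *: ((F \o shift t) (h *: (1 : R)) - F t) =
    h^-1 *: ((f \o shift (y + t *: v)) (h *: v) - f (y + t *: v)).
  rewrite /F /=; congr (_ *: (f _ - _)).
  by rewrite [h *: 1]mulr1 scalerDl addrCA addrA.
have Ed : derivable F t 1 = derivable f (y + t *: v) v.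
  by rewrite /derivable; under eq_fun do rewrite E.
have El : 'D_1 F t = 'D_v f (y + t *: v).
  by rewrite /derive; under eq_fun do rewrite E.
split=> -[h1 h2]; apply: DeriveDef.
- by rewrite -Ed.
- by rewrite -El.
- by rewrite Ed.
- by rewrite El.
Qed.

Lemma is_derive_line0 (f : V -> R) (y v : V) (l : R) :
  is_derive (0 : R) (1 : R) (fun s : R => f (y + s *: v)) l ->
  is_derive y v f l.
Proof. by move/is_derive_lineP; rewrite scale0r addr0. Qed.

Lemma cvg_difference_quotient (f : V -> R) (y v : V) (l : R) :
  is_derive y v f l ->
  (f (y + n.+1%:R^-1 *: v) - f y) * n.+1%:R @[n --> \oo] --> l.
Proof.
move=> [dv <-].
pose q (h : R) := h^-1 *: ((f \o shift y) (h *: v) - f y).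
have /cvgr_dnbhsP : q h @[h --> 0^'] --> 'D_v f y by exact: dv.
move=> /(_ (fun n => n.+1%:R^-1)) h.
have := h (conj (fun n => invr_neq0 (lt0r_neq0 (ltr0Sn _ n))) cvg_harmonic).
rewrite /q /=; apply: cvg_trans; apply: near_eq_cvg; apply: nearW => n.
by rewrite invrK [RHS]mulrC [y + _]addrC.
Qed.

End directional.

(** * Domination by the Cauchy weight; partial derivatives integrate to zero *)

Section decay.
Variables (R : realType) (d : nat).
Local Notation mR := (measurableTypeR R).
Local Notation lam := (lebesgue_tuple R d).
Local Notation col := (@col_of_tuple R d).
Implicit Types (u v : 'cV[R]_d -> R) (x y p : 'cV[R]_d).

Definition weight y : R := \prod_i (1 + y i 0 ^+ 2)^-1.

Lemma weight1_gt0 (r : R) : 0 < 1 + r ^+ 2.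
Proof. by rewrite ltr_pwDl// sqr_ge0. Qed.

Lemma measurable_cauchy : measurable_fun [set: mR] (fun r : R => (1 + r ^+ 2)^-1).
Proof.
apply: (@continuous_measurable_fun R) => x; apply: cvgV.
  exact/lt0r_neq0/weight1_gt0.
by apply: cvgD; [exact: cvg_cst|exact: exprn_continuous].
Qed.

Lemma weight_gt0 y : 0 < weight y.
Proof. by apply: prodr_gt0 => i _; rewrite invr_gt0 weight1_gt0. Qed.

Definition decay u := exists M : R, forall y, `|u y| <= M * weight y.

Lemma integrable_weight : lam.-integrable setT (fun t => (weight (col t))%:E).
Proof.
apply: eq_integrable (@integrable_prod_tuple R d _ measurable_cauchy _ _) => //.
- by move=> t _; congr EFin; apply: eq_bigr => i _; rewrite col_of_tupleE.
- by move=> x; rewrite invr_ge0 ltW ?weight1_gt0.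
- by rewrite integral_cauchy ltry.
Qed.

Lemma integrable_decay u : continuous u -> decay u ->
  lam.-integrable setT (fun t => (u (col t))%:E).
Proof.
move=> cu [M uM]; have := integrableZl measurableT M integrable_weight.
apply: le_integrable => //; first by apply/measurable_EFinP; exact: measurable_col.
by move=> t _; rewrite lee_fin (le_trans (uM _))// ler_norm.
Qed.

(* The constant comes from y^2 <= 2 (y + s)^2 + 2 s^2. *)
Lemma weight_shift y (i : 'I_d) (s : R) : `|s| <= 1 ->
  weight (y + s *: delta_mx i 0) <= 3 * weight y.
Proof.
move=> s1.
have wE z : weight z = (1 + z i 0 ^+ 2)^-1 * \prod_(j | j != i) (1 + z j 0 ^+ 2)^-1.
  by rewrite /weight (bigD1 i).
rewrite !wE mulrA.
have -> : \prod_(j | j != i) (1 + (y + s *: delta_mx i 0) j 0 ^+ 2)^-1 =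
    \prod_(j | j != i) (1 + y j 0 ^+ 2)^-1.
  by apply: eq_bigr => j ji; rewrite !mxE (negbTE ji)/= mulr0 addr0.
apply: ler_wpM2r.
  by apply: prodr_ge0 => j _; rewrite invr_ge0 ltW ?weight1_gt0.
rewrite !mxE !eqxx/= mulr1 ler_pdivlMr ?weight1_gt0// mulrC.
rewrite ler_pdivrMr ?weight1_gt0//.
have : s ^+ 2 <= 1 by rewrite -real_normK ?num_real// expr_le1.
by have := sqr_ge0 (y i 0 + 2 * s); have := sqr_ge0 (y i 0); nra.
Qed.

Lemma col_affine (m : 'I_d -> R) (c : R) (t : d.-tuple mR) :
  col (affine m c t) = (\col_i m i) + c *: col t.
Proof. by apply/colP => i; rewrite !mxE tnth_mktuple. Qed.

Lemma Rintegral_shift u y : lam.-integrable setT (fun t => (u (col t))%:E) ->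
  \int[lam]_t u (col t + y) = \int[lam]_t u (col t).
Proof.
move=> ui; rewrite [RHS](Rintegral_affine (fun i => y i 0) ltr01)//.
rewrite expr1n mul1r; apply: eq_Rintegral => t _; congr u.
by rewrite col_affine scale1r addrC; congr (_ + _); apply/colP => i; rewrite mxE.
Qed.

(* By translation invariance the difference quotients of h have integral 0;
   they converge dominatedly to g. *)
Lemma integral_partial0 (h g : 'cV[R]_d -> R) (i : 'I_d) :
  continuous h -> continuous g -> decay h -> decay g ->
  (forall y, is_derive y (delta_mx i 0) h (g y)) ->
  \int[lam]_t g (col t) = 0.
Proof.
move=> ch cg dh dg hg; have [M gM] := dg.
pose e : 'cV[R]_d := delta_mx i 0.
pose D n y := (h (y + n.+1%:R^-1 *: e) - h y) * n.+1%:R.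
have hi := integrable_decay ch dh.
have hsi n : lam.-integrable setT (fun t => (h (col t + n.+1%:R^-1 *: e))%:E).
  have := integrable_affine (fun j => (n.+1%:R^-1 *: e) j 0) ltr01 hi.
  apply: eq_integrable => // t _ /=; congr (h _)%:E.
  by rewrite col_affine scale1r addrC; congr (_ + _); apply/colP => j; rewrite mxE.
have hdi n : lam.-integrable setT
    (fun t => (h (col t + n.+1%:R^-1 *: e) - h (col t))%:E).
  exact: eq_integrable (integrableB measurableT (hsi n) hi).
have D0 n : (\int[lam]_t (D n (col t))%:E = 0)%E.
  rewrite /D; under eq_integral do rewrite mulrC EFinM.
  rewrite integralZl//.
  rewrite (integralB_EFin measurableT (hsi n) hi).
  have := congr1 EFin (Rintegral_shift (n.+1%:R^-1 *: e) hi).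
  rewrite /Rintegral !fineK ?integrable_fin_num// => ->.
  by rewrite subee ?integrable_fin_num// mule0.
have cl : (\int[lam]_t (D n (col t))%:E @[n --> \oo] --> \int[lam]_t (g (col t))%:E)%E.
  apply: (@dominated_cvg _ _ _ _ _ _ _ _ (fun t => (3 * M)%:E * (weight (col t))%:E)%E) => //.
  - move=> n; apply: (measurable_int lam).
    apply: eq_integrable (integrableZl measurableT n.+1%:R (hdi n)) => // t _.
    by rewrite /D mulrC EFinM.
  - move=> t _; apply: cvg_EFin; first exact: nearW.
    exact: cvg_difference_quotient.
  - by apply: integrableZl => //; exact: integrable_weight.
  (* By the mean value theorem the quotient is a value of [g] at distance less than 1 along [e];
     [weight_shift] brings the bound back to the base point at the cost of the factor 3. *)
  - move=> n t _; rewrite lee_fin.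
    have n0 : 0 < n.+1%:R^-1 :> R by rewrite invr_gt0.
    have dl (s : R) : is_derive s 1 (fun s : R => h (col t + s *: e)) (g (col t + s *: e)).
      by apply/is_derive_lineP; exact: hg.
    have [|c cI] := @MVT R (fun s : R => h (col t + s *: e)) (fun s => g (col t + s *: e)) 0 _ n0.
      by apply: derivable_within_continuous => s _; apply: ex_derive.
    rewrite scale0r addr0 subr0 /D => ->; rewrite -mulrA mulVf// mulr1.
    rewrite (le_trans (gM _))// [3 * M]mulrC -mulrA ler_wpM2l//.
      have := gM 0; rewrite -(ler_pdivrMr _ _ (weight_gt0 _)).
      by apply: le_trans; rewrite divr_ge0// ltW// weight_gt0.
    apply: weight_shift; move: cI; rewrite in_itv/= => /andP[c0 c1].
    rewrite gtr0_norm// (le_trans (ltW c1))// invf_le1//.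
    by rewrite ler1n.
have : (0 = \int[lam]_t (g (col t))%:E)%E.
  apply: (cvg_unique _ _ cl) => //.
  rewrite (_ : (fun n => \int[lam]_t (D n (col t))%:E)%E = cst 0%E).
    exact: cvg_cst.
  by apply/funext => n; rewrite D0.
by rewrite /Rintegral => <-.
Qed.

End decay.

Section continuous_real.
Variables (R : realType) (T : topologicalType).
Implicit Types f g : T -> R.

Lemma continuous_mul f g : continuous f -> continuous g ->
  continuous (fun y => f y * g y).
Proof. by move=> cf cg y; exact: (continuousM (cf y) (cg y)). Qed.

Lemma continuous_add f g : continuous f -> continuous g ->
  continuous (fun y => f y + g y).
Proof. by move=> cf cg y; exact: (continuousD (cf y) (cg y)). Qed.

Lemma continuous_sub f g : continuous f -> continuous g ->
  continuous (fun y => f y - g y).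
Proof. by move=> cf cg y; exact: (continuousB (cf y) (cg y)). Qed.

Lemma continuous_inv f : (forall y, f y != 0) -> continuous f ->
  continuous (fun y => (f y)^-1).
Proof. by move=> f0 cf y; exact: (continuousV (f0 y) (cf y)). Qed.

Lemma continuous_const (c : R) : continuous (fun _ : T => c).
Proof. by move=> y; exact: cst_continuous. Qed.

Lemma continuous_compR f (h : R -> R) : continuous h -> continuous f ->
  continuous (fun y => h (f y)).
Proof. by move=> ch cf y; apply: continuous_comp; [exact: cf|exact: ch]. Qed.

End continuous_real.

(** * Fourier integrals with a phase *)

Section fourier.
Variables (R : realType) (d : nat).
Local Notation mR := (measurableTypeR R).
Local Notation lam := (lebesgue_tuple R d).
Local Notation col := (@col_of_tuple R d).
Implicit Types (u v : 'cV[R]_d -> R) (x y p : 'cV[R]_d).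

Definition dotp p x : R := \sum_i p i 0 * x i 0.

Lemma continuous_dotp p x : continuous (fun y => dotp p (x - y)).
Proof.
rewrite (_ : (fun y => _) = (fun y => \sum_i p i 0 * (x i 0 - y i 0))); last first.
  by apply/funext => y; apply: eq_bigr => i _; rewrite !mxE.
apply: (@continuous_big _ _ _ _ _ (@add_continuous R)) => i _.
apply: continuous_mul; first exact: continuous_const.
by apply: continuous_sub; [exact: continuous_const|exact: coord_continuous].
Qed.

Lemma continuous_cos_dotp (phi : R) p x :
  continuous (fun y => cos (phi + dotp p (x - y))).
Proof.
apply: continuous_compR; first exact: continuous_cos.
by apply: continuous_add; [exact: continuous_const|exact: continuous_dotp].
Qed.

Lemma continuous_sin_dotp (phi : R) p x :
  continuous (fun y => sin (phi + dotp p (x - y))).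
Proof.
apply: continuous_compR; first exact: continuous_sin.
by apply: continuous_add; [exact: continuous_const|exact: continuous_dotp].
Qed.

Lemma dotp_shift p z (i : 'I_d) (s : R) :
  dotp p (z - s *: delta_mx i 0) = dotp p z - p i 0 * s.
Proof.
rewrite /dotp (bigD1 i)//= [in RHS](bigD1 i)//= !mxE !eqxx/= mulr1 mulrBr.
rewrite addrAC; congr (_ + _ - _).
by apply: eq_bigr => j ji; rewrite !mxE (negbTE ji)/= mulr0 subr0.
Qed.

Lemma is_derive_sin_dotp (phi : R) p x y (i : 'I_d) :
  is_derive y (delta_mx i 0) (fun y => sin (phi + dotp p (x - y)))
    (- p i 0 * cos (phi + dotp p (x - y))).
Proof.
apply: is_derive_line0.
under eq_fun do rewrite opprD addrA dotp_shift.
apply: is_derive_eq.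
rewrite /GRing.scale/= mulr0 subr0; ring.
Qed.

Lemma normr_sin_le1 (r : R) : `|sin r| <= 1.
Proof. by rewrite ler_norml sin_geN1 sin_le1. Qed.

Lemma weight_le1 y : weight y <= 1.
Proof.
apply: prodr_ile1 => i _; rewrite invr_ge0 ltW ?weight1_gt0//=.
by rewrite invf_le1 ?weight1_gt0// lerDl sqr_ge0.
Qed.

Lemma decay_bounded u : decay u -> exists2 M : R, 0 <= M & forall y, `|u y| <= M.
Proof.
move=> [M uM]; have M0 : 0 <= M.
  have := le_trans (normr_ge0 _) (uM 0); rewrite pmulr_lge0//; exact: weight_gt0.
exists M => // y; rewrite (le_trans (uM y))// ler_piMr//; exact: weight_le1.
Qed.

Lemma decayD u v : decay u -> decay v -> decay (fun y => u y + v y).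
Proof.
move=> [M uM] [N vN]; exists (M + N) => y.
by rewrite (le_trans (ler_normD _ _))// mulrDl lerD.
Qed.

Lemma decayMr u (b : 'cV[R]_d -> R) (B : R) : decay u -> (forall y, `|b y| <= B) ->
  decay (fun y => u y * b y).
Proof.
move=> [M uM] bB; exists (M * B) => y.
by rewrite normrM mulrAC ler_pM.
Qed.

(* The phase phi lets one family of real integrals cover both parts of the
   Fourier kernel: phi = 0 for cos and phi = - pi / 2 for sin. *)
Definition fourier u (phi : R) x p : R :=
  \int[lam]_t (u (col t) * cos (phi + dotp p (x - col t))).

Lemma integrable_fourier u phi x p : continuous u -> decay u ->
  lam.-integrable setT (fun t => (u (col t) * cos (phi + dotp p (x - col t)))%:E).
Proof.
move=> cu du.
apply: (integrable_decay (u := fun y => u y * cos (phi + dotp p (x - y)))).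
  by apply: continuous_mul; [exact: cu|exact: continuous_cos_dotp].
by apply: decayMr du _ => y; exact: normr_cos_le1.
Qed.

(** Integration by parts: the partial derivative of u sin (phi + p.(x - y)) has integral 0.
    Differentiating the sine gives - p_i times the integrand on the left, and the sine left next to
    [v] is a cosine with phase lowered by pi / 2. *)
Lemma fourier_partial u v phi x p (i : 'I_d) :
  continuous u -> decay u -> continuous v -> decay v ->
  (forall y, is_derive y (delta_mx i 0) u (v y)) ->
  p i 0 * fourier u phi x p = fourier v (phi - pi / 2) x p.
Proof.
move=> cu du cv dv uv.
pose h y := u y * sin (phi + dotp p (x - y)).
pose g y := v y * sin (phi + dotp p (x - y)) +
  u y * (- p i 0 * cos (phi + dotp p (x - y))).
have iu := integrable_fourier phi x p cu du.
have iv := integrable_fourier (phi - pi / 2) x p cv dv.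
have : \int[lam]_t g (col t) = 0.
  apply: (@integral_partial0 _ _ h g i).
  - by apply: continuous_mul; [exact: cu|exact: continuous_sin_dotp].
  - apply: continuous_add; apply: continuous_mul;
      [exact: cv|exact: continuous_sin_dotp|exact: cu|].
    by apply: continuous_mul; [exact: continuous_const|exact: continuous_cos_dotp].
  - by apply: decayMr du _ => y; exact: normr_sin_le1.
  - apply: decayD.
      by apply: decayMr dv _ => y; exact: normr_sin_le1.
    apply: (decayMr (B := `|p i 0|)) du _ => y.
    by rewrite normrM normrN ler_piMr// normr_cos_le1.
  - move=> y; have du' := uv y; have ds := is_derive_sin_dotp phi p x y i.
    apply: is_derive_eq; rewrite /g /GRing.scale/=; ring.
have -> : (fun t => g (col t)) = (fun t =>
    v (col t) * cos (phi - pi / 2 + dotp p (x - col t)) -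
    p i 0 * (u (col t) * cos (phi + dotp p (x - col t)))).
  by apply/funext => t; rewrite /g addrAC cosBpihalf; ring.
rewrite RintegralB//; last exact: (integrableZl measurableT (p i 0) iu).
rewrite RintegralZl// => /eqP; rewrite subr_eq0 => /eqP.
by rewrite /fourier => ->.
Qed.

Lemma le_normr_fourier u phi x p : continuous u -> decay u ->
  `|fourier u phi x p| <= \int[lam]_t `|u (col t)|.
Proof.
move=> cu du; have iu := integrable_fourier phi x p cu du.
rewrite (le_trans (le_normr_Rintegral measurableT iu))//.
apply: le_Rintegral => //.
- exact: integrable_norm.
- exact: integrable_norm (integrable_decay cu du).
- by move=> t _; rewrite normrM ler_piMr// normr_cos_le1.
Qed.

(** Tonelli's measurability statement concerns nonnegative integrands, so the kernel is split into
    its positive and negative parts. *)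
Lemma measurable_fourier u phi x : continuous u ->
  measurable_fun setT (fun t => fourier u phi x (col t)).
Proof.
move=> cu; pose f (z : d.-tuple mR * d.-tuple mR) : \bar R :=
  (u (col z.2) * cos (phi + dotp (col z.1) (x - col z.2)))%:E.
have mf : measurable_fun setT f.
  apply/measurable_EFinP; apply: measurable_funM.
    exact: measurableT_comp (measurable_col cu) _.
  apply: measurableT_comp.
    by apply: (@continuous_measurable_fun R); exact: continuous_cos.
  apply: measurable_funD => //; apply: measurable_sum => i.
  under eq_fun do rewrite !mxE.
  apply: measurable_funM; last apply: measurable_funB => //;
    exact: measurableT_comp (measurable_tnth i) _.
have mp := measurable_fun_fubini_tonelli_F (m2 := lam) f^\+%E.
have mn := measurable_fun_fubini_tonelli_F (m2 := lam) f^\-%E.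
apply: (measurableT_comp (f := fine)) => //.
rewrite (_ : (fun t => _) = (fun t => \int[lam]_y f^\+%E (t, y) - \int[lam]_y f^\-%E (t, y))%E).
  apply: emeasurable_funB.
    by apply: mp; [exact: measurable_funepos|move=> z; exact: funepos_ge0].
  by apply: mn; [exact: measurable_funeneg|move=> z; exact: funeneg_ge0].
apply/funext => t; rewrite integralE; congr (_ - _)%E; apply: eq_integral => y _.
  by rewrite funepos.unlock.
by rewrite funeneg.unlock.
Qed.

End fourier.

(** * Inversion by Abel summation *)

Section inversion.
Variables (R : realType) (d : nat).
Local Notation mR := (measurableTypeR R).
Local Notation lam := (lebesgue_tuple R d).
Local Notation col := (@col_of_tuple R d).
Implicit Types (u v : 'cV[R]_d -> R) (x y p : 'cV[R]_d).

(** Derivatives and differences are the operations from which u - d_i^2 u is built, so such a class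
    can absorb as many of these operators as there are coordinates. *)
Record derivation_closed (K : ('cV[R]_d -> R) -> Prop) : Prop := DerivationClosed {
  dc_continuous : forall u, K u -> continuous u;
  dc_decay : forall u, K u -> decay u;
  dc_derive : forall u (i : 'I_d), K u ->
    exists2 v, K v & forall y, is_derive y (delta_mx i 0) u (v y);
  dc_sub : forall u v, K u -> K v -> K (fun y => u y - v y) }.

Lemma fourierB u v phi x p : continuous u -> decay u -> continuous v -> decay v ->
  fourier (fun y => u y - v y) phi x p = fourier u phi x p - fourier v phi x p.
Proof.
move=> cu du cv dv; rewrite /fourier -RintegralB//; last 2 first.
- exact: integrable_fourier.
- exact: integrable_fourier.
by apply: eq_Rintegral => t _; rewrite mulrBl.
Qed.

Section derivation_closed_class.
Variables (K : ('cV[R]_d -> R) -> Prop) (hK : derivation_closed K).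

(** Two integrations by parts lower the phase by pi, which reverses the sign of the cosine: p_i^2
    acts as - d_i^2, and the witness is u - d_i^2 u. *)
Lemma fourier_oneD_sqr u (i : 'I_d) : K u ->
  exists2 w, K w & forall phi x p,
    (1 + p i 0 ^+ 2) * fourier u phi x p = fourier w phi x p.
Proof.
move=> Ku; have [v Kv uv] := dc_derive hK i Ku; have [w Kw vw] := dc_derive hK i Kv.
have [[cu cv] cw] := (dc_continuous hK Ku, dc_continuous hK Kv, dc_continuous hK Kw).
have [[du dv] dw] := (dc_decay hK Ku, dc_decay hK Kv, dc_decay hK Kw).
exists (fun y => u y - w y) => [|phi x p]; first exact: dc_sub.
rewrite fourierB// mulrDl mul1r; congr (_ + _).
rewrite expr2 -mulrA (fourier_partial _ _ _ cu du cv dv uv).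
rewrite (fourier_partial _ _ _ cv dv cw dw vw) /fourier -[RHS]mulN1r -RintegralZl//.
  apply: eq_Rintegral => t _.
  by rewrite addrAC cosBpihalf addrAC sinBpihalf; ring.
exact: integrable_fourier.
Qed.

Lemma fourier_prod_oneD_sqr u (s : seq 'I_d) : K u ->
  exists2 w, K w & forall phi x p,
    \prod_(i <- s) (1 + p i 0 ^+ 2) * fourier u phi x p = fourier w phi x p.
Proof.
move=> Ku; elim: s => [|i s [w Kw uw]].
  by exists u => // phi x p; rewrite big_nil mul1r.
have [w' Kw' ww'] := fourier_oneD_sqr i Kw.
by exists w' => // phi x p; rewrite big_cons -mulrA uw ww'.
Qed.

Lemma fourier_decay u phi x : K u -> decay (fourier u phi x).
Proof.
move=> Ku; have [w Kw uw] := fourier_prod_oneD_sqr (index_enum 'I_d) Ku.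
exists (\int[lam]_t `|w (col t)|) => p.
have := @le_normr_fourier _ _ w phi x p (dc_continuous hK Kw) (dc_decay hK Kw).
rewrite -uw normrM ger0_norm; last first.
  by apply: prodr_ge0 => i _; rewrite ltW ?weight1_gt0.
rewrite /weight prodfV mulrC -ler_pdivlMr//.
by apply: prodr_gt0 => i _; exact: weight1_gt0.
Qed.

Lemma integrable_fourier_transform u phi x : K u ->
  lam.-integrable setT (fun t => (fourier u phi x (col t))%:E).
Proof.
move=> Ku; have [M uM] := fourier_decay phi x Ku.
have := integrableZl measurableT M (@integrable_weight R d).
apply: le_integrable => //.
  apply/measurable_EFinP; apply: measurable_fourier; exact: dc_continuous hK _ Ku.
by move=> t _; rewrite lee_fin (le_trans (uM _))// ler_norm.
Qed.

End derivation_closed_class.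

(** Product over the coordinates of the half-plane Poisson kernels at height [dl], multiplied by (2
    pi)^d. *)
Definition poisson_kernel (dl : R) x : R := \prod_i (2 * dl / (dl ^+ 2 + x i 0 ^+ 2)).

Lemma fourier_abel u phi x (dl : R) : 0 < dl -> continuous u -> decay u ->
  (\int[lam]_t ((\prod_i abel dl (tnth t i)) * fourier u phi x (col t))%:E =
   \int[lam]_t (u (col t) * (cos phi * poisson_kernel dl (x - col t)))%:E)%E.
Proof.
move=> dl0 cu du.
pose A (t : d.-tuple mR) : R := \prod_i abel dl (tnth t i).
have A0 t : 0 <= A t by apply: prodr_ge0 => i _; exact: abel_ge0.
have iA : lam.-integrable setT (EFin \o A) by exact: integrable_prod_abel.
pose f (z : d.-tuple mR * d.-tuple mR) : \bar R :=
  (A z.1 * (u (col z.2) * cos (phi + dotp (col z.1) (x - col z.2))))%:E.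
have mA : measurable_fun setT A by exact: measurable_prod_abel.
have mf : measurable_fun setT f.
  apply/measurable_EFinP; apply: measurable_funM.
    exact: measurableT_comp mA _.
  apply: measurable_funM; first exact: measurableT_comp (measurable_col cu) _.
  apply: measurableT_comp.
    by apply: (@continuous_measurable_fun R); exact: continuous_cos.
  apply: measurable_funD => //; apply: measurable_sum => i.
  under eq_fun do rewrite !mxE.
  apply: measurable_funM; last apply: measurable_funB => //;
    exact: measurableT_comp (measurable_tnth i) _.
have iu := integrable_decay cu du.
pose U := (\int[lam]_t `|u (col t)|%:E)%E.
have Ufin : U \is a fin_num.
  exact: (integrable_fin_num measurableT (integrable_norm iu)).
(* The cosine is bounded by 1, so [f] is dominated by the product of [A] in the first variable and
   |u| in the second. The Abel factor is what makes the double integral absolutely convergent. *)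
have fi : (lam \x lam)%E.-integrable setT f.
  apply: (integrable12ltyP lam lam mf).2.
  apply: (@le_lt_trans _ _ (\int[lam]_t (U * (A t)%:E))%E).
    apply: ge0_le_integral => //.
    - by move=> t _; exact: integral_ge0.
    - apply: (measurable_fun_fubini_tonelli_F (abse \o f)).
        exact: measurableT_comp.
      by move=> z; exact: abse_ge0.
    - by apply: measurable_funeM; exact: measurable_int iA.
    move=> t _; rewrite muleC -ge0_integralZl//=; last 2 first.
    - exact: measurable_int (integrable_norm iu).
    - by rewrite lee_fin.
    apply: ge0_le_integral => //.
    - apply/measurable_EFinP; apply: measurableT_comp => //.
      apply: measurable_funM => //.
      apply: (measurable_col (f := fun y => u y * cos (phi + dotp (col t) (x - y)))).
      by apply: continuous_mul => //; exact: continuous_cos_dotp.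
    - by apply: measurable_funeM; exact: measurable_int (integrable_norm iu).
    - move=> y _; rewrite -EFinM lee_fin !normrM (ger0_norm (A0 _)) ler_wpM2l//.
      by rewrite ler_piMr// normr_cos_le1.
  rewrite -(fineK Ufin) integralZl//.
  by rewrite ltey_eq fin_numM//; exact: integrable_fin_num.
transitivity (\int[lam]_p \int[lam]_y f (p, y))%E.
  apply: eq_integral => p _; rewrite /f /= EFinM.
  under [RHS]eq_integral do rewrite EFinM.
  rewrite integralZl//; last exact: integrable_fourier.
  by rewrite /fourier /Rintegral fineK// integrable_fin_num//; exact: integrable_fourier.
(* After the exchange, the integral over p at fixed y is [integral_prod_abel_cos] with s = x - y. *)
rewrite (Fubini fi); apply: eq_integral => y _; rewrite /f /=.
rewrite EFinM -(integral_prod_abel_cos (fun i => (x - col y) i 0) phi dl0).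
rewrite -integralZl//; last exact: integrable_prod_abel_cos.
apply: eq_integral => p _; rewrite -EFinM mulrCA; congr (_ * (_ * cos (_ + _)))%:E.
by apply: eq_bigr => i _; rewrite mxE.
Qed.

Lemma cvg_abel (z : R) : abel n.+1%:R^-1 z @[n --> \oo] --> (1 : R).
Proof.
have h : - (n.+1%:R^-1 * `|z|) @[n --> \oo] --> - (0 * `|z|).
  by apply: cvgN; apply: cvgMl; exact: cvg_harmonic.
rewrite mul0r oppr0 in h; rewrite -[X in _ --> X]expR0.
by apply: continuous_cvg h; exact: continuous_expR.
Qed.

(** Substituting x + dl y for y turns the kernel into 2^d dl^-d times the weight, and the Jacobian
    cancels dl^-d. Afterwards [dl] occurs only in the argument of [u], so one multiple of the weight
    dominates for every [dl]. *)
Lemma integral_poisson_kernel u phi x (dl : R) : 0 < dl -> continuous u -> decay u ->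
  (\int[lam]_t (u (col t) * (cos phi * poisson_kernel dl (x - col t)))%:E =
   \int[lam]_t (cos phi * 2 ^+ d * (u (x + dl *: col t) * weight (col t)))%:E)%E.
Proof.
move=> dl0 cu du.
pose g (t : d.-tuple mR) := u (col t) * (cos phi * poisson_kernel dl (x - col t)).
have poisson_kernel_ge0 y : 0 <= poisson_kernel dl y.
  apply: prodr_ge0 => i _; rewrite divr_ge0 ?mulr_ge0 ?(ltW dl0)//.
  by rewrite addr_ge0 ?sqr_ge0.
have D0 (r : R) : 0 < dl ^+ 2 + r ^+ 2 by rewrite ltr_pwDl ?sqr_ge0 ?exprn_gt0.
have cp : continuous (fun y => poisson_kernel dl (x - y)).
  rewrite /poisson_kernel (_ : (fun y => _) =
      (fun y => \prod_i (2 * dl / (dl ^+ 2 + (x i 0 - y i 0) ^+ 2)))); last first.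
    by apply/funext => y; apply: eq_bigr => i _; rewrite !mxE.
  apply: (@continuous_big _ _ _ _ _ (@mul_continuous R)) => i _.
  apply: continuous_mul; first exact: continuous_const.
  apply: continuous_inv => [y|]; first exact: lt0r_neq0.
  apply: continuous_add; first exact: continuous_const.
  apply: (continuous_compR (h := fun r => r ^+ 2)); first exact: exprn_continuous.
  by apply: continuous_sub; [exact: continuous_const|exact: coord_continuous].
have gi : lam.-integrable setT (EFin \o g).
  apply: (integrable_decay (u := fun y => u y * (cos phi * poisson_kernel dl (x - y)))).
    apply: continuous_mul => //; apply: continuous_mul => //.
    exact: continuous_const.
  (* Each factor of the kernel is largest at the origin, where it equals 2 / dl. *)
  apply: (decayMr (B := \prod_(i < d) (2 / dl))) => // y.
  rewrite normrM (ger0_norm (poisson_kernel_ge0 _)) -[leRHS]mul1r ler_pM ?normr_cos_le1//.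
  apply: ler_prod => i _; rewrite divr_ge0 ?mulr_ge0 ?(ltW dl0) ?(ltW (D0 _))//=.
  rewrite ler_pdivrMr// [leRHS](_ : _ = 2 * dl + 2 / dl * (x - y) i 0 ^+ 2).
    by rewrite lerDl mulr_ge0 ?sqr_ge0 ?divr_ge0 ?(ltW dl0).
  by field; exact: lt0r_neq0.
have := congr1 EFin (Rintegral_affine (fun i => x i 0) dl0 gi).
have := integrable_affine (fun i => x i 0) dl0 gi => gai.
rewrite EFinM /Rintegral !fineK ?integrable_fin_num// => ->.
rewrite -integralZl//; apply: eq_integral => t _; rewrite -EFinM /g col_affine.
have -> : (\col_i x i 0 : 'cV[R]_d) = x by apply/colP => i; rewrite mxE.
have -> : poisson_kernel dl (x - (x + dl *: col t)) = \prod_i (2 / dl * (1 + col t i 0 ^+ 2)^-1).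
  apply: eq_bigr => i _; rewrite !mxE; set r := tnth t i.
  have r0 := lt0r_neq0 (weight1_gt0 r).
  have -> : dl ^+ 2 + (x i 0 - (x i 0 + dl * r)) ^+ 2 = dl ^+ 2 * (1 + r ^+ 2) by ring.
  by field; rewrite r0 lt0r_neq0.
rewrite big_split /= prodr_const card_ord /weight; congr EFin.
by rewrite expr_div_n; field; rewrite expf_neq0// lt0r_neq0.
Qed.

Lemma continuous_affine_col x (c : R) : continuous (fun y => x + c *: y).
Proof.
apply: continuous_col => i.
rewrite (_ : (fun y => _) = (fun y => x i 0 + c * y i 0)); last first.
  by apply/funext => y; rewrite !mxE.
apply: continuous_add; first exact: continuous_const.
by apply: continuous_mul; [exact: continuous_const|exact: coord_continuous].
Qed.

Lemma fourier_inversion (K : ('cV[R]_d -> R) -> Prop) u phi x :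
  derivation_closed K -> K u ->
  \int[lam]_t fourier u phi x (col t) = (2 * pi) ^+ d * (u x * cos phi).
Proof.
move=> hK Ku; have [cu du] := (dc_continuous hK Ku, dc_decay hK Ku).
have iF := integrable_fourier_transform hK phi x Ku.
pose dl n : R := n.+1%:R^-1.
have dl0 n : 0 < dl n by rewrite invr_gt0.
pose A n (t : d.-tuple mR) : R := \prod_i abel (dl n) (tnth t i).
pose L n := (\int[lam]_t (A n t * fourier u phi x (col t))%:E)%E.
have A01 n t : 0 <= A n t <= 1.
  rewrite prodr_ge0; last by move=> i _; exact: abel_ge0.
  rewrite prodr_ile1// => i _; rewrite abel_ge0 -expR0 ler_expR oppr_le0.
  by rewrite mulr_ge0 ?(ltW (dl0 n)).
(* The Abel factors lie between 0 and 1 and tend to 1, so the transform itself dominates. *)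
have L1 : L n @[n --> \oo] --> (\int[lam]_t (fourier u phi x (col t))%:E)%E.
  apply: (@dominated_cvg _ _ _ _ _ _ _ _ (fun t => `|fourier u phi x (col t)|%:E)) => //.
  - move=> n; apply/measurable_EFinP; apply: measurable_funM.
      exact: measurable_prod_abel.
    by apply: measurable_fourier.
  - move=> t _; apply: cvg_EFin; first exact: nearW.
    rewrite -[X in _ --> X]mul1r; apply: cvgMl.
    rewrite [X in _ --> X](_ : 1 = \prod_(i < d) (1 : R)); last by rewrite big1.
    apply: (cvg_big (@mul_continuous R)) => i _; exact: cvg_abel.
  - exact: integrable_norm.
  - move=> n t _; rewrite lee_fin normrM; have /andP[a0 a1] := A01 n t.
    by rewrite ler_piMl// ger0_norm.
(* On the convolution side the argument of [u] tends to [x]; the dominating function is a bound of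
   |u| times the weight. *)
have L2 : L n @[n --> \oo] -->
    (\int[lam]_t (cos phi * 2 ^+ d * (u x * weight (col t)))%:E)%E.
  rewrite (_ : L = fun n => (\int[lam]_t (cos phi * 2 ^+ d *
      (u (x + dl n *: col t) * weight (col t)))%:E)%E); last first.
    by apply/funext => n; rewrite /L fourier_abel// integral_poisson_kernel.
  have [M M0 uM] := decay_bounded du.
  apply: (@dominated_cvg _ _ _ _ _ _ _ _
    (fun t => (`|cos phi * 2 ^+ d| * M)%:E * (weight (col t))%:E)%E) => //.
  - move=> n; apply/measurable_EFinP; apply: measurable_funM => //.
    apply: measurable_funM; last first.
      by apply/measurable_EFinP; exact: measurable_int (@integrable_weight R d).
    apply: (measurable_col (f := fun y => u (x + dl n *: y))) => y.
    by apply: continuous_comp; [exact: continuous_affine_col|exact: cu].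
  - move=> t _; apply: cvg_EFin; first exact: nearW.
    apply: cvgMr; apply: cvgMl; apply: continuous_cvg; first exact: cu.
    apply: cvg_col => i.
    have h : x i 0 + dl n * tnth t i @[n --> \oo] --> x i 0 + 0 * tnth t i.
      by apply: cvgD; [exact: cvg_cst|apply: cvgMl; exact: cvg_harmonic].
    rewrite mul0r addr0 in h.
    by apply: cvg_trans h; apply: near_eq_cvg; apply: nearW => n; rewrite !mxE.
  - by apply: integrableZl => //; exact: integrable_weight.
  - move=> n t _; rewrite lee_fin normrM -mulrA ler_wpM2l// normrM.
    by rewrite (gtr0_norm (weight_gt0 _)) ler_wpM2r// ltW// weight_gt0.
rewrite {1}/Rintegral (cvg_unique _ L1 L2)// -/(Rintegral _ _ _).
under eq_Rintegral do rewrite mulrA.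
rewrite RintegralZl//; last exact: integrable_weight.
(* Together with the [2 ^+ d] of the kernel, this produces the constant (2 pi)^d. *)
have -> : \int[lam]_t weight (col t) = pi ^+ d.
  have g0 (r : R) : 0 <= (1 + r ^+ 2)^-1 by rewrite invr_ge0 ltW ?weight1_gt0.
  have := @ge0_integral_prod_tuple R d _ (@measurable_cauchy R) g0.
  rewrite /Rintegral integral_cauchy ltry => /(_ isT)/(congr1 fine) /= <-.
  by congr fine; apply: eq_integral => t _; congr EFin; apply: eq_bigr => i _; rewrite mxE.
by rewrite exprMn; ring.
Qed.

End inversion.

(** * The Gaussian integral *)

Section gaussian_integral.
Variable R : realType.
Local Notation mR := (measurableTypeR R).
Local Notation mu := (@lebesgue_measure R).
Local Notation lam := (lebesgue_tuple R).

Definition qform n (A : 'M[R]_n) (v : 'cV[R]_n) : R := (v^T *m A *m v) 0 0.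

Lemma continuous_qform n (A : 'M[R]_n) : continuous (qform A).
Proof.
rewrite (_ : qform A = fun v => \sum_j (\sum_i v i 0 * A i j) * v j 0); last first.
  apply/funext => v; rewrite /qform mxE; apply: eq_bigr => j _; rewrite mxE.
  by congr (_ * _); apply: eq_bigr => i _; rewrite mxE.
apply: (@continuous_big _ _ _ _ _ (@add_continuous R)) => j _.
apply: continuous_mul; last exact: coord_continuous.
apply: (@continuous_big _ _ _ _ _ (@add_continuous R)) => i _.
by apply: continuous_mul; [exact: coord_continuous|exact: continuous_const].
Qed.

Lemma measurable_gauss1 (a b : R) :
  measurable_fun [set: mR] (fun x : mR => (expR (- (a * (x + b) ^+ 2)))%:E).
Proof.
apply/measurable_EFinP; apply: (@continuous_measurable_fun R).
apply: (continuous_compR (h := expR)); first exact: continuous_expR.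
apply: (continuous_compR (h := fun r => - r)).
  by move=> x; apply: cvgN; exact: cvg_id.
apply: continuous_mul; first exact: continuous_const.
apply: (continuous_compR (h := fun r => r ^+ 2)); first exact: exprn_continuous.
by apply: continuous_add; [move=> x; exact: cvg_id|exact: continuous_const].
Qed.

(** The substitution x = - b + y / sqrt a reduces to the standard Gaussian integral. *)
Lemma integral_gauss1 (a b : R) : 0 < a ->
  (\int[mu]_x (expR (- (a * (x + b) ^+ 2)))%:E = (Num.sqrt pi / Num.sqrt a)%:E)%E.
Proof.
move=> a0; have c0 : 0 < (Num.sqrt a)^-1 by rewrite invr_gt0 sqrtr_gt0.
rewrite (ge0_integral_affine1 (- b) c0) => [||x]; last 2 first.
- exact: measurable_gauss1.
- by rewrite lee_fin expR_ge0.
rewrite [RHS]EFinM muleC -integralT_gauss; congr (_ * _)%E.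
apply: eq_integral => x _; rewrite /gauss_fun; congr (expR (- _))%:E.
rewrite addrAC addNr add0r exprMn exprVn sqr_sqrtr ?ltW// mulrA divff ?mul1r//.
exact: lt0r_neq0.
Qed.

Section schur.
Variables (n : nat) (A : 'M[R]_(1 + n)) (symA : A^T = A) (posA : posdef A).
Let a := A ord0 ord0.
Let b : 'rV[R]_n := ursubmx A.
Let D : 'M[R]_n := drsubmx A.

Definition schur : 'M[R]_n := D - a^-1 *: (b^T *m b).

Lemma block_sym : A = block_mx a%:M b b^T D.
Proof.
rewrite -[LHS]submxK; congr (block_mx _ _ _ _).
  by apply/matrixP => i j; rewrite !ord1 !mxE eqxx mulr1n; congr (A _ _); exact: val_inj.
by rewrite /b trmx_ursub symA.
Qed.

(** Completing the square in the first coordinate: by symmetry the cross terms are 2 x (b t), and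
    the correction (b t)^2 / a is what the Schur complement subtracts from [D]. *)
Lemma qform_col_mx (x : R) (t : 'cV[R]_n) : a != 0 ->
  qform A (col_mx x%:M t) = a * (x + a^-1 * (b *m t) 0 0) ^+ 2 + qform schur t.
Proof.
move=> a0; rewrite {1}block_sym /qform tr_col_mx mul_row_block mul_row_col.
rewrite /schur mulmxBr mulmxBl -scalemxAr -scalemxAl.
have -> : t^T *m (b^T *m b) *m t = (b *m t)^T *m (b *m t) by rewrite trmx_mul !mulmxA.
rewrite tr_scalar_mx -!scalar_mxM.
rewrite -trmx_mul; set s := b *m t.
rewrite mulmxDl -scalar_mxM mul_mx_scalar mulmxDl mul_scalar_mx -scalemxAl -/s.
have -> : s^T *m s = (s 0 0 ^+ 2)%:M.
  by rewrite [LHS]mx11_scalar mxE big_ord1 mxE.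
have E (M N : 'M[R]_1) : (M + N) 0 0 = M 0 0 + N 0 0 by rewrite mxE.
have EN (M : 'M[R]_1) : (- M) 0 0 = - M 0 0 by rewrite mxE.
have EZ c (M : 'M[R]_1) : (c *: M) 0 0 = c * M 0 0 by rewrite mxE.
have ES c : (c%:M : 'M[R]_1) 0 0 = c by rewrite mxE eqxx mulr1n.
by rewrite !(E, EN, EZ, ES) [s^T 0 0]mxE; field.
Qed.

Lemma pivot_gt0 : 0 < a.
Proof.
have v0 : (delta_mx ord0 0 : 'cV[R]_(1 + n)) != 0.
  apply/eqP => /colP/(_ ord0); rewrite !mxE !eqxx => /eqP.
  by rewrite oner_eq0.
have := posA v0; rewrite trmx_delta -rowE.
by rewrite [X in 0 < X]mxE (bigD1 ord0)//= big1 ?addr0 => [|i i0];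
  rewrite !mxE !eqxx ?mulr1// (negbTE i0) mulr0.
Qed.

Lemma schur_sym : schur^T = schur.
Proof.
by rewrite /schur linearB linearZ /= trmx_mul trmxK /D trmx_drsub symA.
Qed.

Lemma schur_posdef : posdef schur.
Proof.
(* This [x] annihilates the completed square, leaving only the form of the Schur complement. *)
move=> t t0; pose x : R := - (a^-1 * (b *m t) 0 0).
have v0 : col_mx x%:M t != 0.
  by apply: contraNneq t0 => h; rewrite -(col_mxKd x%:M t) h linear0.
have := posA v0; rewrite -/(qform A _) qform_col_mx; last exact/lt0r_neq0/pivot_gt0.
by rewrite /x addNr expr0n/= mulr0 add0r.
Qed.

Lemma det_schur : \det A = a * \det schur.
Proof.
have a0 := lt0r_neq0 pivot_gt0.
(* One step of Gaussian elimination, as a block LU factorisation. *)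
have E : A = block_mx 1%:M 0 (a^-1 *: b^T) 1%:M *m block_mx a%:M b 0 schur.
  rewrite [LHS]block_sym mulmx_block !mul0mx !mul1mx !addr0.
  rewrite -scalemxAl mul_mx_scalar scalerA mulVf// scale1r.
  by rewrite -scalemxAl /schur addrC subrK.
by rewrite E det_mulmx det_lblock det_ublock !det1 !mul1r det_scalar expr1.
Qed.

End schur.

Lemma col_tuple_cons n (x : mR) (t : n.-tuple mR) :
  col_of_tuple (tuple_cons (x, t)) = col_mx (x%:M : 'M[R]_1) (col_of_tuple t).
Proof.
apply/colP => i; rewrite mxE.
case: (unliftP ord0 i) => [j|] -> /=.
  rewrite tnthS (_ : lift ord0 j = rshift 1 j); last exact: val_inj.
  by rewrite [RHS](col_mxEd (x%:M : 'M[R]_1) (col_of_tuple t) j 0) mxE.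
transitivity (col_mx (x%:M : 'M[R]_1) (col_of_tuple t) (lshift n ord0) 0).
  by rewrite col_mxEu mxE.
by congr (fun_of_matrix _ _ _); exact: val_inj.
Qed.

(** Positivity of the determinant follows by the same induction, since [det_schur] factors it
    through the pivot; it is used again for the normalisation of the wave packet. *)
Lemma integral_gauss_qform n (A : 'M[R]_n) : A^T = A -> posdef A ->
  0 < \det A /\
  (\int[lam n]_t (expR (- qform A (col_of_tuple t)))%:E =
   (Num.sqrt pi ^+ n / Num.sqrt (\det A))%:E)%E.
Proof.
have mE k (B : 'M[R]_k) : measurable_fun setT (fun t : k.-tuple mR =>
    (expR (- qform B (col_of_tuple t)))%:E).
  apply/measurable_EFinP.
  apply: (measurable_col (f := fun v => expR (- qform B v))).
  apply: (continuous_compR (h := expR)); first exact: continuous_expR.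
  apply: (continuous_compR (h := fun r => - r)).
    by move=> x; apply: cvgN; exact: cvg_id.
  exact: continuous_qform.
elim: n A => [|n IH] A symA posA.
  rewrite det_mx00; split => //.
  rewrite integral_dirac//; last exact: mE.
  rewrite diracE in_setT mul1e.
  by rewrite /qform mxE big_ord0 oppr0 expR0 expr0 sqrtr1 divr1.
have a0 := pivot_gt0 posA.
have [dS IS] := IH _ (schur_sym symA) (schur_posdef symA posA).
rewrite (det_schur symA posA); split; first exact: mulr_gt0.
rewrite ge0_integral_tupleS_swap => [|//|t]; last by rewrite lee_fin expR_ge0.
have E (t : n.-tuple mR) :
    (\int[mu]_x (expR (- qform A (col_of_tuple (tuple_cons (x, t)))))%:E =
     (Num.sqrt pi / Num.sqrt (A ord0 ord0))%:E *
     (expR (- qform (schur A) (col_of_tuple t)))%:E)%E.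
  under eq_integral do rewrite col_tuple_cons
    (qform_col_mx symA _ _ (lt0r_neq0 a0)) opprD expRD mulrC EFinM.
  rewrite ge0_integralZl ?lee_fin ?expR_ge0//=; last exact: measurable_gauss1.
  by rewrite integral_gauss1// muleC.
under eq_integral do rewrite E.
rewrite ge0_integralZl ?lee_fin ?divr_ge0 ?sqrtr_ge0//=; last exact: mE.
rewrite IS -EFinM exprS sqrtrM ?ltW// invfM; congr EFin; ring.
Qed.

End gaussian_integral.

(** * Wave packets applied to a Schwartz function *)

Section modulated_class.
Variables (R : realType) (d : nat).
Implicit Types (u v w : 'cV[R]_d -> R) (x y : 'cV[R]_d).

Definition rapid_decay u := forall a : 'I_d -> nat,
  exists M : R, forall y, `|\prod_i y i 0 ^+ a i| * `|u y| <= M.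

Lemma rapid_decay_coord u (j : 'I_d) : rapid_decay u ->
  rapid_decay (fun y => y j 0 * u y).
Proof.
move=> du a; have [M uM] := du (fun i => (a i + (i == j))%N).
exists M => y; apply: le_trans (uM y).
rewrite normrM mulrA -normrM; apply: ler_wpM2r => //.
rewrite (_ : _ * y j 0 = \prod_i y i 0 ^+ (a i + (i == j)))//.
under [RHS]eq_bigr do rewrite exprD.
rewrite big_split /=; congr (_ * _).
rewrite (bigD1 j)//= eqxx expr1 big1 ?mulr1// => i /negbTE ->.
by rewrite expr0.
Qed.

(** The product of the 1 + y_i^2 is expanded one coordinate at a time. The induction generalises
    [u], because its hypothesis is applied both to [u] and to y_i^2 u. *)
Lemma rapid_decay_decay u : rapid_decay u -> decay u.
Proof.
move=> du.
have [M uM] : exists M : R, forall y,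
    \prod_i (1 + y i 0 ^+ 2) * `|u y| <= M.
  elim: (index_enum 'I_d) (u) du => [|i s IH] {}u du.
    have [M uM] := du (fun=> 0%N); exists M => y.
    rewrite big_nil mul1r; have := uM y.
    by rewrite big1 ?normr1 ?mul1r// => i _; rewrite expr0.
  have [M uM] := IH u du.
  have [N uN] := IH _ (rapid_decay_coord i (rapid_decay_coord i du)).
  exists (M + N) => y; apply: le_trans (lerD (uM y) (uN y)).
  by rewrite big_cons !normrM -(real_normK (num_real (y i 0))); lra.
exists M => y; rewrite /weight prodfV ler_pdivlMr.
  by rewrite mulrC.
by apply: prodr_gt0 => i _; exact: weight1_gt0.
Qed.

Definition affine_derivative (al : 'cV[R]_d -> R) := forall i : 'I_d,
  exists (c : R) (m : 'I_d -> R), forall y,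
    is_derive y (delta_mx i 0) al (c + \sum_j m j * y j 0).

Variables (W : ('cV[R]_d -> R) -> Prop) (al be : 'cV[R]_d -> R).

Record derivative_stable : Prop := DerivativeStable {
  ds_continuous : forall w, W w -> continuous w;
  ds_decay : forall w, W w -> rapid_decay w;
  ds_derive : forall w (i : 'I_d), W w ->
    exists2 v, W v & forall y, is_derive y (delta_mx i 0) w (v y) }.

(* The functions obtained from W by differentiation, once W is modulated by
   exp (- be) cos (al + phi): since al and be are quadratic, their derivatives
   only bring out affine factors. *)
Inductive modulated : ('cV[R]_d -> R) -> Prop :=
| modulated_base w phi : W w ->
    modulated (fun y => expR (- be y) * cos (al y + phi) * w y)
| modulated_add u v : modulated u -> modulated v -> modulated (fun y => u y + v y)
| modulated_scale c u : modulated u -> modulated (fun y => c * u y)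
| modulated_coord j u : modulated u -> modulated (fun y => y j 0 * u y).

Lemma modulated_sum (I : Type) (s : seq I) (f : I -> 'cV[R]_d -> R) u0 :
  modulated u0 -> (forall i, modulated (f i)) ->
  modulated (fun y => u0 y + \sum_(i <- s) f i y).
Proof.
move=> hu hf; elim: s => [|i s IH].
  by under eq_fun do rewrite big_nil addr0.
under eq_fun do rewrite big_cons addrCA.
exact: modulated_add.
Qed.

Lemma modulated_affine (c : R) (m : 'I_d -> R) u : modulated u ->
  modulated (fun y => (c + \sum_j m j * y j 0) * u y).
Proof.
move=> hu.
rewrite (_ : (fun y => _) = fun y => c * u y + \sum_j m j * (y j 0 * u y)).
  apply: modulated_sum; first exact: modulated_scale.
  by move=> j; apply: modulated_scale; exact: modulated_coord.
apply/funext => y; rewrite mulrDl mulr_suml; congr (_ + _).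
by apply: eq_bigr => j _; rewrite mulrA.
Qed.

Hypotheses (hW : derivative_stable) (be0 : forall y, 0 <= be y).
Hypotheses (cal : continuous al) (cbe : continuous be).
Hypotheses (dal : affine_derivative al) (dbe : affine_derivative be).

Lemma modulated_continuous u : modulated u -> continuous u.
Proof.
elim=> [w phi Ww|{}u v _ cu _ cv|c {}u _ cu|j {}u _ cu].
- apply: continuous_mul; last exact: ds_continuous.
  apply: continuous_mul.
    apply: (continuous_compR (h := expR)); first exact: continuous_expR.
    apply: (continuous_compR (h := fun r => - r)) => //.
    by move=> r; apply: cvgN; exact: cvg_id.
  apply: (continuous_compR (h := cos)); first exact: continuous_cos.
  by apply: continuous_add => //; exact: continuous_const.
- exact: continuous_add.
- by apply: continuous_mul => //; exact: continuous_const.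
- by apply: continuous_mul => //; exact: coord_continuous.
Qed.

Lemma modulated_rapid_decay u : modulated u -> rapid_decay u.
Proof.
elim=> [w phi Ww|{}u v _ du _ dv|c {}u _ du|j {}u _ du]; last exact: rapid_decay_coord.
- move=> a; have [M wM] := ds_decay hW Ww a; exists M => y.
  apply: le_trans (wM y); apply: ler_wpM2l => //.
  rewrite 2!normrM ler_piMl// mulr_ile1// ?normr_cos_le1//.
  by rewrite ger0_norm ?expR_ge0// -expR0 ler_expR oppr_le0.
- move=> a; have [[M uM] [N vN]] := (du a, dv a); exists (M + N) => y.
  apply: le_trans (lerD (uM y) (vN y)); rewrite -mulrDr ler_wpM2l//.
  exact: ler_normD.
- move=> a; have [M uM] := du a; exists (`|c| * M) => y.
  by rewrite normrM mulrCA ler_wpM2l.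
Qed.

(** The sine produced by differentiation is written as a cosine with phase raised by pi / 2, so all
    three terms keep the shape of a generator of [modulated]. *)
Lemma is_derive1_base (w1 al1 be1 : R -> R) (phi l a b t : R) :
  is_derive t 1 w1 l -> is_derive t 1 al1 a -> is_derive t 1 be1 b ->
  is_derive t 1 (fun s => expR (- be1 s) * cos (al1 s + phi) * w1 s)
   (expR (- be1 t) * cos (al1 t + phi) * l +
    (- b * (expR (- be1 t) * cos (al1 t + phi) * w1 t) +
    a * (expR (- be1 t) * cos (al1 t + (phi + pi / 2)) * w1 t))).
Proof.
move=> dw da db; apply: is_derive_eq.
by rewrite (addrA (al1 t)) cosDpihalf /GRing.scale/=; ring.
Qed.

Lemma is_derive_base w phi (i : 'I_d) y (l a b : R) :
  is_derive y (delta_mx i 0) w l -> is_derive y (delta_mx i 0) al a ->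
  is_derive y (delta_mx i 0) be b ->
  is_derive y (delta_mx i 0) (fun y => expR (- be y) * cos (al y + phi) * w y)
   (expR (- be y) * cos (al y + phi) * l +
    (- b * (expR (- be y) * cos (al y + phi) * w y) +
    a * (expR (- be y) * cos (al y + (phi + pi / 2)) * w y))).
Proof.
have y0 : y = y + 0 *: delta_mx i 0 by rewrite scale0r addr0.
move=> dw da db; apply: is_derive_line0.
rewrite y0 in dw da db.
have := is_derive1_base phi ((is_derive_lineP _ _ _ _ _).2 dw)
  ((is_derive_lineP _ _ _ _ _).2 da) ((is_derive_lineP _ _ _ _ _).2 db).
by rewrite /= -y0.
Qed.

Lemma is_derive_coord (i j : 'I_d) y :
  is_derive y (delta_mx i 0) (fun y : 'cV[R]_d => y j 0) ((j == i)%:R).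
Proof.
apply: is_derive_line0.
rewrite (_ : (fun s : R => _) = (fun s : R => y j 0 + s * (j == i)%:R)); last first.
  by apply/funext => s; rewrite !mxE eqxx andbT.
by apply: is_derive_eq; rewrite /GRing.scale/=; ring.
Qed.

Lemma modulated_derive u (i : 'I_d) : modulated u ->
  exists2 v, modulated v & forall y, is_derive y (delta_mx i 0) u (v y).
Proof.
elim=> [w phi Ww|{}u v _ [u' hu' du] _ [v' hv' dv]|c {}u _ [u' hu' du]|j {}u hu [u' hu' du]].
- have [w' Ww' dw] := ds_derive hW i Ww.
  have [ca [ma da]] := dal i; have [cb [mb db]] := dbe i.
  eexists; last by move=> y; exact: is_derive_base (dw y) (da y) (db y).
  apply: modulated_add; first exact: modulated_base.
  apply: modulated_add; last by apply: modulated_affine; exact: modulated_base.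
  under eq_fun do rewrite mulNr -mulN1r.
  by apply: modulated_scale; apply: modulated_affine; exact: modulated_base.
- by exists (fun y => u' y + v' y); [exact: modulated_add|move=> y; exact: is_deriveD].
- exists (fun y => c * u' y); first exact: modulated_scale.
  move=> y; have duy := du y.
  by apply: (is_derive_eq (f := fun y => c * u y)); rewrite /GRing.scale/=; lra.
- exists (fun y => y j 0 * u' y + (j == i)%:R * u y).
    by apply: modulated_add; [exact: modulated_coord|exact: modulated_scale].
  move=> y; have duy := du y; have dj := is_derive_coord i j y.
  by apply: is_derive_eq; rewrite /GRing.scale/=; lra.
Qed.

Lemma modulated_derivation_closed : derivation_closed modulated.
Proof.
split.
- exact: modulated_continuous.
- by move=> u hu; apply: rapid_decay_decay; exact: modulated_rapid_decay.
- by move=> u i; exact: modulated_derive.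
- move=> u v hu hv; under eq_fun do rewrite -mulN1r.
  by apply: modulated_add => //; exact: modulated_scale.
Qed.

End modulated_class.

(** * Quadratic forms have affine partial derivatives *)

Section qform_derivative.
Variables (R : realType) (d : nat).

Lemma qformE (A : 'M[R]_d) v : qform A v = \sum_i \sum_j v i 0 * A i j * v j 0.
Proof.
rewrite /qform mxE exchange_big /=; apply: eq_bigr => j _.
by rewrite mxE mulr_suml; apply: eq_bigr => i _; rewrite mxE.
Qed.

Lemma qform_line (A : 'M[R]_d) (z e : 'cV[R]_d) (s : R) :
  qform A (z + s *: e) = qform A z +
    s * ((e^T *m A *m z) 0 0 + (z^T *m A *m e) 0 0) + s ^+ 2 * qform A e.
Proof.
have E (M N : 'M[R]_1) : (M + N) 0 0 = M 0 0 + N 0 0 by rewrite mxE.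
have EZ c (M : 'M[R]_1) : (c *: M) 0 0 = c * M 0 0 by rewrite mxE.
rewrite /qform.
have -> : (z + s *: e)^T = z^T + s *: e^T by apply/matrixP => i j; rewrite !mxE.
rewrite !mulmxDl !mulmxDr -!scalemxAl -!scalemxAr.
by rewrite !(E, EZ); ring.
Qed.

Lemma continuous_qform_shift (A : 'M[R]_d) (c : R) (q : 'cV[R]_d) :
  continuous (fun y : 'cV[R]_d => c * qform A (y - q)).
Proof.
rewrite (_ : (fun y => _) = (fun y => c * qform A (- q + 1 *: y))); last first.
  by apply/funext => y; rewrite scale1r addrC.
apply: continuous_mul; first exact: continuous_const.
move=> y; apply: continuous_comp; last exact: continuous_qform.
exact: continuous_affine_col.
Qed.

Lemma affine_derivative_qform (A : 'M[R]_d) (c : R) (q : 'cV[R]_d) :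
  affine_derivative (fun y : 'cV[R]_d => c * qform A (y - q)).
Proof.
move=> i; pose e : 'cV[R]_d := delta_mx i 0.
(* Row and column [i] of [A] both contribute to the gradient; the constant term below accounts for
   the centre [q]. *)
pose m j : R := c * (A i j + A j i).
exists (- \sum_j m j * q j 0), m => y.
apply: is_derive_line0.
have -> : (fun s : R => c * qform A (y + s *: delta_mx i 0 - q)) =
    (fun s : R => c * qform A ((y - q) + s *: e)).
  by apply/funext => s; rewrite addrAC.
under eq_fun do rewrite qform_line.
apply: is_derive_eq.
rewrite /GRing.scale/= -sumrN -big_split /= trmx_delta -mulmxA -rowE.
rewrite [((y - q)^T *m A *m e) 0 0](_ : _ = \sum_j A j i * (y - q) j 0).
  rewrite [(row i _) 0 0](_ : _ = \sum_j A i j * (y - q) j 0).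
    have -> : \sum_j (- (m j * q j 0) + m j * y j 0) =
        c * (\sum_j A i j * (y - q) j 0 + \sum_j A j i * (y - q) j 0).
      rewrite -big_split mulr_sumr; apply: eq_bigr => j _.
      by rewrite /m !mxE /=; ring.
    ring.
  by rewrite [LHS]mxE mxE; apply: eq_bigr => j _.
by rewrite /e -colE [LHS]mxE mxE; apply: eq_bigr => j _; rewrite mxE mulrC.
Qed.

End qform_derivative.

(** * Polar form of the wave packet *)

Section complex_gaussian.
Variables (R : realType) (d : nat).
Local Notation mR := (measurableTypeR R).
Local Notation lam := (lebesgue_tuple R d).
Local Notation col := (@col_of_tuple R d).
Local Notation Re := (@complex.Re R).
Local Notation Im := (@complex.Im R).

Lemma complexP (z w : R[i]) : Re z = Re w -> Im z = Im w -> z = w.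
Proof. by case: z w => [a b] [a' b'] /= -> ->. Qed.

Lemma ReM (z w : R[i]) : Re (z * w) = Re z * Re w - Im z * Im w.
Proof. by case: z w => [a b] [a' b']. Qed.

Lemma ImM (z w : R[i]) : Im (z * w) = Re z * Im w + Im z * Re w.
Proof. by case: z w => [a b] [a' b']. Qed.

Lemma ReD (z w : R[i]) : Re (z + w) = Re z + Re w.
Proof. by case: z w => [a b] [a' b']. Qed.

Lemma ImD (z w : R[i]) : Im (z + w) = Im z + Im w.
Proof. by case: z w => [a b] [a' b']. Qed.

Lemma Re_sum (I : Type) (s : seq I) (f : I -> R[i]) :
  Re (\sum_(i <- s) f i) = \sum_(i <- s) Re (f i).
Proof. by apply: (big_morph Re) => // -[a b] [a' b']. Qed.

Lemma Im_sum (I : Type) (s : seq I) (f : I -> R[i]) :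
  Im (\sum_(i <- s) f i) = \sum_(i <- s) Im (f i).
Proof. by apply: (big_morph Im) => // -[a b] [a' b']. Qed.

Lemma normr_Re_le_modc (z : R[i]) : `|Re z| <= modc z.
Proof.
by case: z => a b; rewrite /modc /= -sqrtr_sqr ler_wsqrtr// lerDl sqr_ge0.
Qed.

Lemma normr_Im_le_modc (z : R[i]) : `|Im z| <= modc z.
Proof.
by case: z => a b; rewrite /modc /= -sqrtr_sqr ler_wsqrtr// lerDr sqr_ge0.
Qed.

Lemma modc_real (r : R) : modc (real_complex R r) = `|r|.
Proof. by rewrite /modc /= expr0n addr0 sqrtr_sqr. Qed.

Lemma Re_qform (C : 'M[R[i]]_d) (z : 'cV[R]_d) :
  Re (((map_mx (real_complex R) z)^T *m C *m map_mx (real_complex R) z) 0 0) =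
  qform (map_mx Re C) z.
Proof.
rewrite qformE mxE Re_sum exchange_big /=; apply: eq_bigr => j _.
rewrite !mxE mulr_suml Re_sum; apply: eq_bigr => i _.
by rewrite !mxE !(ReM, ImM) /=; ring.
Qed.

Lemma Im_qform (C : 'M[R[i]]_d) (z : 'cV[R]_d) :
  Im (((map_mx (real_complex R) z)^T *m C *m map_mx (real_complex R) z) 0 0) =
  qform (map_mx Im C) z.
Proof.
rewrite qformE mxE Im_sum exchange_big /=; apply: eq_bigr => j _.
rewrite !mxE mulr_suml Im_sum; apply: eq_bigr => i _.
by rewrite !mxE !(ReM, ImM) /=; ring.
Qed.

Variables (eps : R) (C : 'M[R[i]]_d).

Definition gauss_peak : R :=
  (pi * eps) `^ (- (d%:R / 4)) * (\det (map_mx Im C)) `^ (1 / 4).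

Definition gauss_amp (z : 'cV[R]_d) : R :=
  gauss_peak * expR (- ((2 * eps)^-1 * qform (map_mx Im C) z)).

Definition gauss_phase (z : 'cV[R]_d) : R := (2 * eps)^-1 * qform (map_mx Re C) z.

(** The factor i / eps sends Im C to the modulus, and Re C and p to the angle. The momentum enters
    only through the angle, linearly, which makes the integral over p a Fourier integral with
    frequency p / eps. *)
Lemma gaussianE q p x : gaussian eps C q p x =
  Complex (gauss_amp (x - q) *
             cos (gauss_phase (x - q) + dotp (eps^-1 *: p) (x - q)))
          (gauss_amp (x - q) *
             sin (gauss_phase (x - q) + dotp (eps^-1 *: p) (x - q))).
Proof.
rewrite /gaussian -/gauss_peak /gauss_amp; set z := x - q.
set w := _ * (1 / 2 * _ + _).
have i2 : (1 / 2 : R[i]) = real_complex R (1 / 2).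
  by rewrite !div1r fmorphV rmorph_nat.
have wE : w = Complex 0 1 * real_complex R eps^-1 *
    (real_complex R (1 / 2) *
      (((map_mx (real_complex R) z)^T *m C *m map_mx (real_complex R) z) 0 0) +
     real_complex R (dotp p z)).
  rewrite /w fmorphV i2 [(p^T *m z) 0 0](_ : _ = dotp p z)//.
  by rewrite mxE; apply: eq_bigr => i _; rewrite mxE.
have dZ : dotp (eps^-1 *: p) z = eps^-1 * dotp p z.
  by rewrite mulr_sumr; apply: eq_bigr => i _; rewrite mxE mulrA.
have wR : Re w = - ((2 * eps)^-1 * qform (map_mx Im C) z).
  rewrite wE !(ReM, ImM, ReD, ImD) /= Re_qform Im_qform invfM; lra.
have wI : Im w = gauss_phase z + dotp (eps^-1 *: p) z.
  by rewrite wE !(ReM, ImM, ReD, ImD) /= Re_qform Im_qform /gauss_phase invfM dZ; lra.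
by apply: complexP; rewrite !(ReM, ImM) /= wR wI; ring.
Qed.

End complex_gaussian.

(** * Derivatives of a Schwartz function *)

Section schwartz_class.
Variables (R : realType) (d : nat).

Definition partial_parts (psi : 'cV[R]_d -> R[i]) (w : 'cV[R]_d -> R) : Prop :=
  exists s : seq 'I_d,
    w = (fun y => complex.Re (cpartials s psi y)) \/
    w = (fun y => complex.Im (cpartials s psi y)).

(** Differentiating in direction [i] prepends [i] to the word, so the class is stable by
    construction. *)
Lemma schwartz_derivative_stable psi : schwartz psi ->
  derivative_stable (partial_parts psi).
Proof.
move=> [smooth_psi decay_psi]; split.
- by move=> w [s [|] ->]; have [] := smooth_psi s.
- move=> w [s sE] a; have [M psiM] := decay_psi a s; exists M => y.
  apply: le_trans (psiM y); apply: ler_wpM2l => //.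
  by case: sE => ->; [exact: normr_Re_le_modc|exact: normr_Im_le_modc].
- move=> w i [s [|] ->]; have [_ _ der] := smooth_psi s.
    exists (fun y => complex.Re (cpartials (i :: s) psi y)).
      by exists (i :: s); left.
    by move=> y; apply: derivableP; have [] := der i y.
  exists (fun y => complex.Im (cpartials (i :: s) psi y)).
    by exists (i :: s); right.
  by move=> y; apply: derivableP; have [] := der i y.
Qed.

End schwartz_class.

(** Moving the base point of the kernel from [q] to [x] rotates the cosine and sine transforms by
    the angle p.(x - q). Read from right to left, this merges the angle of the packet at [x] with
    that of the inner product. *)
Lemma fourier_angle (R : realType) (d : nat) (u : 'cV[R]_d -> R) phi (x q p : 'cV[R]_d) :
  continuous u -> decay u ->
  fourier u phi x p = cos (phi + dotp p (x - q)) * fourier u 0 q p -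
    sin (phi + dotp p (x - q)) * fourier u (- (pi / 2)) q p.
Proof.
move=> cu du; have iu ph := integrable_fourier ph q p cu du.
rewrite /fourier -[X in X - _](RintegralZl _ measurableT (iu 0)).
rewrite -[X in _ - X](RintegralZl _ measurableT (iu (- (pi / 2)))).
rewrite -RintegralB; first last.
- exact: (integrableZl measurableT _ (iu (- (pi / 2)))).
- exact: (integrableZl measurableT _ (iu 0)).
- by [].
apply: eq_Rintegral => t _.
have -> : phi + dotp p (x - col_of_tuple t) =
    phi + dotp p (x - q) + dotp p (q - col_of_tuple t).
  rewrite -addrA; congr (_ + _); rewrite /dotp -big_split; apply: eq_bigr => i _.
  by rewrite !mxE /=; ring.
by rewrite add0r [- _ + _]addrC cosBpihalf cosD; ring.
Qed.

(** * The momentum integral *)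

Section momentum.
Variables (R : realType) (d : nat) (eps : R) (C : 'M[R[i]]_d)
  (psi : 'cV[R]_d -> R[i]) (q : 'cV[R]_d).
Hypotheses (heps : 0 < eps) (hC : siegel C) (hpsi : schwartz psi).
Local Notation mR := (measurableTypeR R).
Local Notation lam := (lebesgue_tuple R d).
Local Notation col := (@col_of_tuple R d).
Local Notation Re := (@complex.Re R).
Local Notation Im := (@complex.Im R).
Local Notation amp := (gauss_amp eps C).
Local Notation phase := (gauss_phase eps C).

(* The real and imaginary parts of conj(g_(q,0)) psi. *)
Definition windowed_re y : R := amp (y - q) *
  (cos (phase (y - q)) * Re (psi y) + sin (phase (y - q)) * Im (psi y)).

Definition windowed_im y : R := amp (y - q) *
  (cos (phase (y - q)) * Im (psi y) - sin (phase (y - q)) * Re (psi y)).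

Definition windowed_class : ('cV[R]_d -> R) -> Prop :=
  modulated (partial_parts psi)
    (fun y => (2 * eps)^-1 * qform (map_mx Re C) (y - q))
    (fun y => (2 * eps)^-1 * qform (map_mx Im C) (y - q)).

Lemma qform_ge0 n (A : 'M[R]_n) v : posdef A -> 0 <= qform A v.
Proof.
move=> pA; have [->|v0] := eqVneq v 0; first by rewrite /qform mulmx0 mxE.
exact: ltW (pA v v0).
Qed.

Lemma windowed_closed : derivation_closed windowed_class.
Proof.
apply: modulated_derivation_closed.
- exact: schwartz_derivative_stable.
- move=> y; rewrite mulr_ge0 ?invr_ge0 ?mulr_ge0 ?(ltW heps)//.
  by apply: qform_ge0; case: hC.
- exact: continuous_qform_shift.
- exact: continuous_qform_shift.
- exact: affine_derivative_qform.
- exact: affine_derivative_qform.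
Qed.

Lemma windowed_re_class : windowed_class windowed_re.
Proof.
have pRe : partial_parts psi (fun y => Re (psi y)) by exists [::]; left.
have pIm : partial_parts psi (fun y => Im (psi y)) by exists [::]; right.
have := modulated_scale (gauss_peak eps C) (modulated_add
  (modulated_base (fun y => (2 * eps)^-1 * qform (map_mx Re C) (y - q))
    (fun y => (2 * eps)^-1 * qform (map_mx Im C) (y - q)) 0 pRe)
  (modulated_base _ _ (- (pi / 2)) pIm)).
congr modulated; apply/funext => y.
by rewrite /windowed_re /gauss_amp /gauss_phase addr0 cosBpihalf; ring.
Qed.

Lemma windowed_im_class : windowed_class windowed_im.
Proof.
have pRe : partial_parts psi (fun y => Re (psi y)) by exists [::]; left.
have pIm : partial_parts psi (fun y => Im (psi y)) by exists [::]; right.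
have := modulated_scale (gauss_peak eps C) (modulated_add
  (modulated_base (fun y => (2 * eps)^-1 * qform (map_mx Re C) (y - q))
    (fun y => (2 * eps)^-1 * qform (map_mx Im C) (y - q)) 0 pIm)
  (modulated_base _ _ (pi / 2) pRe)).
congr modulated; apply/funext => y.
by rewrite /windowed_im /gauss_amp /gauss_phase addr0 cosDpihalf; ring.
Qed.

Let cU := dc_continuous windowed_closed windowed_re_class.
Let cV := dc_continuous windowed_closed windowed_im_class.
Let dU := dc_decay windowed_closed windowed_re_class.
Let dV := dc_decay windowed_closed windowed_im_class.

Local Notation "'p_' p" := (eps^-1 *: p) (at level 2).

Lemma dotp_opp (p z : 'cV[R]_d) : dotp p (- z) = - dotp p z.
Proof. by rewrite /dotp -sumrN; apply: eq_bigr => i _; rewrite mxE mulrN. Qed.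

(** Conjugation reverses the angle, giving a kernel based at [q]; the term - V sin of the real part
    is V times a cosine with phase pi / 2, where V is [windowed_im]. *)
Lemma Re_inner_integrand p y : Re (conjc (gaussian eps C q p y) * psi y) =
  windowed_re y * cos (0 + dotp (p_ p) (q - y)) +
  windowed_im y * cos (pi / 2 + dotp (p_ p) (q - y)).
Proof.
rewrite gaussianE ReM /= -[q - y]opprB dotp_opp add0r [pi / 2 + _]addrC cosDpihalf.
rewrite cosN sinN cosD sinD /windowed_re /windowed_im; ring.
Qed.

Lemma Im_inner_integrand p y : Im (conjc (gaussian eps C q p y) * psi y) =
  windowed_im y * cos (0 + dotp (p_ p) (q - y)) +
  windowed_re y * cos (- (pi / 2) + dotp (p_ p) (q - y)).
Proof.
rewrite gaussianE ImM /= -[q - y]opprB dotp_opp add0r [- (pi / 2) + _]addrC cosBpihalf.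
rewrite cosN sinN cosD sinD /windowed_re /windowed_im; ring.
Qed.

Lemma cintegrable_inner p :
  cintegrable (fun x => conjc (gaussian eps C q p x) * psi x).
Proof.
split.
- under eq_fun do rewrite Re_inner_integrand EFinD.
  by apply: integrableD => //; exact: integrable_fourier.
- under eq_fun do rewrite Im_inner_integrand EFinD.
  by apply: integrableD => //; exact: integrable_fourier.
Qed.

Lemma innerE p : inner (gaussian eps C q p) psi =
  Complex (fourier windowed_re 0 q (p_ p) + fourier windowed_im (pi / 2) q (p_ p))
   (fourier windowed_im 0 q (p_ p) + fourier windowed_re (- (pi / 2)) q (p_ p)).
Proof.
rewrite /inner /cintegral /fourier; congr Complex.
- under eq_Rintegral do rewrite Re_inner_integrand.
  by rewrite RintegralD//; exact: integrable_fourier.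
- under eq_Rintegral do rewrite Im_inner_integrand.
  by rewrite RintegralD//; exact: integrable_fourier.
Qed.

(** By [fourier_angle] the momentum is left only in Fourier integrals based at [x], with phases
    independent of [p], to which inversion applies. *)
Lemma Re_momentum_integrand x p : Re (momentum_integrand eps C psi q x p) =
  amp (x - q) * (fourier windowed_re (phase (x - q)) x (p_ p) +
                 fourier windowed_im (phase (x - q) + pi / 2) x (p_ p)).
Proof.
rewrite /momentum_integrand innerE gaussianE ReM /=.
rewrite (fourier_angle (phase _) x q (p_ p) cU dU).
rewrite (fourier_angle (phase _ + pi / 2) x q (p_ p) cV dV).
(* With both base points equal to [q] the rotation angle is pi / 2 alone; this expresses the phase
   pi / 2 through the phases 0 and - pi / 2 that the two previous rewrites produce. *)
rewrite (fourier_angle (pi / 2) q q (p_ p) cV dV).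
rewrite [_ + pi / 2 + _]addrAC cosDpihalf sinDpihalf.
have -> : dotp (p_ p) (q - q) = 0.
  by rewrite subrr /dotp big1// => i _; rewrite !mxE mulr0.
by rewrite addr0 cos_pihalf sin_pihalf; ring.
Qed.

Lemma Im_momentum_integrand x p : Im (momentum_integrand eps C psi q x p) =
  amp (x - q) * (fourier windowed_re (phase (x - q) - pi / 2) x (p_ p) +
                 fourier windowed_im (phase (x - q)) x (p_ p)).
Proof.
rewrite /momentum_integrand innerE gaussianE ImM /=.
rewrite (fourier_angle (phase _) x q (p_ p) cV dV).
rewrite (fourier_angle (phase _ - pi / 2) x q (p_ p) cU dU).
rewrite (fourier_angle (pi / 2) q q (p_ p) cV dV).
rewrite [_ - pi / 2 + _]addrAC cosBpihalf sinBpihalf.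
have -> : dotp (p_ p) (q - q) = 0.
  by rewrite subrr /dotp big1// => i _; rewrite !mxE mulr0.
by rewrite addr0 cos_pihalf sin_pihalf; ring.
Qed.

Lemma integrable_fourier_scaled u phi x : windowed_class u ->
  lam.-integrable setT (fun t => (fourier u phi x (p_ (col t)))%:E).
Proof.
move=> Ku; have := integrable_fourier_transform windowed_closed phi x Ku.
move/(integrable_affine (fun=> 0)) => /(_ eps^-1); rewrite invr_gt0 => /(_ heps).
apply: eq_integrable => // t _ /=; rewrite col_affine; congr (fourier _ _ _ _)%:E.
by rewrite (_ : \col_i 0 = 0) ?add0r//; apply/colP => i; rewrite !mxE.
Qed.

(** Replacing p by eps p contributes eps^d to the constant (2 pi)^d of the inversion formula, which
    the prefactor of [momentum_integral] then cancels. *)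
Lemma Rintegral_fourier_scaled u phi x : windowed_class u ->
  \int[lam]_t fourier u phi x (p_ (col t)) = (2 * pi * eps) ^+ d * (u x * cos phi).
Proof.
move=> Ku; rewrite (Rintegral_affine (fun=> 0) heps) ?integrable_fourier_scaled//.
have E t : eps^-1 *: col (affine (fun=> 0) eps t) = col t.
  rewrite col_affine (_ : \col_i 0 = 0) ?add0r; last by apply/colP => i; rewrite !mxE.
  by rewrite scalerA mulVf ?scale1r// lt0r_neq0.
under eq_Rintegral do rewrite E.
by rewrite (fourier_inversion phi x windowed_closed Ku) !exprMn; ring.
Qed.

Lemma integrable_fourier_pair a phi phi' x : lam.-integrable setT (fun t =>
  (a * (fourier windowed_re phi x (p_ (col t)) +
        fourier windowed_im phi' x (p_ (col t))))%:E).
Proof.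
under eq_fun do rewrite EFinM EFinD.
apply: integrableZl => //; apply: integrableD => //; apply: integrable_fourier_scaled;
  [exact: windowed_re_class|exact: windowed_im_class].
Qed.

Lemma Rintegral_fourier_pair a phi phi' x :
  \int[lam]_t (a * (fourier windowed_re phi x (p_ (col t)) +
                    fourier windowed_im phi' x (p_ (col t)))) =
  (2 * pi * eps) ^+ d *
    (a * (windowed_re x * cos phi + windowed_im x * cos phi')).
Proof.
have h := integrable_fourier_pair 1 phi phi' x.
have {}h : lam.-integrable setT (EFin \o (fun t =>
    fourier windowed_re phi x (p_ (col t)) + fourier windowed_im phi' x (p_ (col t)))).
  by apply: eq_integrable h => // t _ /=; rewrite mul1r.
rewrite (RintegralZl _ measurableT h) RintegralD//; first last.
- by apply: integrable_fourier_scaled; exact: windowed_im_class.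
- by apply: integrable_fourier_scaled; exact: windowed_re_class.
rewrite Rintegral_fourier_scaled; last exact: windowed_re_class.
rewrite Rintegral_fourier_scaled; last exact: windowed_im_class.
by ring.
Qed.

Lemma cintegrable_momentum x : cintegrable (momentum_integrand eps C psi q x).
Proof.
split.
- by under eq_fun do rewrite Re_momentum_integrand; exact: integrable_fourier_pair.
- by under eq_fun do rewrite Im_momentum_integrand; exact: integrable_fourier_pair.
Qed.

Lemma momentum_integralE x :
  momentum_integral eps C psi q x = real_complex R (amp (x - q) ^+ 2) * psi x.
Proof.
have e0 : (2 * pi * eps) ^+ d != 0.
  by rewrite expf_neq0// !mulf_neq0 ?pnatr_eq0// lt0r_neq0// pi_gt0.
(* The phase of the conjugated window meets that of the packet at [x]; their product reduces to
   cos^2 + sin^2. *)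
have := cos2Dsin2 (phase (x - q)).
rewrite /momentum_integral /cintegral.
under eq_Rintegral do rewrite Re_momentum_integrand.
under [X in Complex _ X]eq_Rintegral do rewrite Im_momentum_integrand.
rewrite !Rintegral_fourier_pair cosDpihalf cosBpihalf /windowed_re /windowed_im.
set c := cos _; set s := sin _ => cs.
apply: complexP; rewrite !(ReM, ImM) /= !mul0r ?subr0 ?addr0 mulrA mulVf// mul1r.
- transitivity (amp (x - q) ^+ 2 * Re (psi x) * (c ^+ 2 + s ^+ 2)); first by ring.
  by rewrite cs mulr1.
- transitivity (amp (x - q) ^+ 2 * Im (psi x) * (c ^+ 2 + s ^+ 2)); first by ring.
  by rewrite cs mulr1.
Qed.

End momentum.

(** * Unordered sums with a common factor *)

Section scaled_sums.
Variables (R : realType) (I : choiceType) (D : set I) (a : I -> R).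
Hypothesis a0 : forall k, 0 <= a k.

Lemma esumZ_le (b : I -> R) (c : R) : (forall k, 0 <= b k) -> 0 <= c ->
  (\esum_(k in D) (c * b k)%:E <= c%:E * \esum_(k in D) (b k)%:E)%E.
Proof.
move=> b0 c0; apply: ge_ereal_sup => _ [X DX <-].
under eq_fsbigr do rewrite EFinM.
rewrite -ge0_mule_fsumr; last by move=> k; rewrite lee_fin.
apply: lee_wpmul2l; first by rewrite lee_fin.
by apply: ereal_sup_ubound; exists X.
Qed.

(** For positive [c] the reverse inequality is [esumZ_le] for the family c a_k and the factor
    c^-1. *)
Lemma esumZ (c : R) : 0 <= c ->
  (\esum_(k in D) (c * a k)%:E = c%:E * \esum_(k in D) (a k)%:E)%E.
Proof.
rewrite le_eqVlt => /orP[/eqP <-|c0].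
  by rewrite mul0e esum1// => k _; rewrite mul0r.
apply/eqP; rewrite eq_le esumZ_le ?(ltW c0)//=.
rewrite muleC -lee_pdivlMr// muleC.
have := @esumZ_le (fun k => c * a k) c^-1.
under eq_esum do rewrite mulKf ?lt0r_neq0//.
by apply; [move=> k; rewrite mulr_ge0 ?(ltW c0)|rewrite invr_ge0 ltW].
Qed.

Hypothesis aoo : (\esum_(k in D) (a k)%:E < +oo)%E.

(** As a_k is nonnegative, the positive and negative parts of a_k r are a_k times those of r, so
    both sums are multiples of the same finite sum. *)
Lemma rsumZ (r : R) :
  rsum D (fun k => a k * r) = fine (\esum_(k in D) (a k)%:E)%E * r.
Proof.
have S0 : (\esum_(k in D) (a k)%:E)%E \is a fin_num.
  by rewrite ge0_fin_numE// esum_ge0// => k _; rewrite lee_fin.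
have E (s : R) : fine (\esum_(k in D) (Num.max (a k * s) 0)%:E)%E =
    fine (\esum_(k in D) (a k)%:E)%E * Num.max s 0.
  rewrite (eq_esum (b := fun k => (Num.max s 0 * a k)%:E)); last first.
    move=> k _; congr EFin; rewrite -[X in Num.max _ X](mulr0 (a k)).
    by rewrite -maxr_pMr// mulrC.
  by rewrite esumZ ?le_max ?lexx ?orbT// fineM// mulrC.
rewrite /rsum E; under [X in _ - fine X]eq_esum do rewrite -mulrN.
rewrite E -mulrBr; congr (_ * _).
by have [r0|r0] := leP r 0; have [nr0|nr0] := leP (- r) 0; lra.
Qed.

End scaled_sums.

Lemma sqrtr_expr (R : rcfType) (x : R) n : 0 <= x ->
  Num.sqrt (x ^+ n) = Num.sqrt x ^+ n.
Proof.
by move=> x0; elim: n => [|n IH]; rewrite ?sqrtr1// !exprS sqrtrM// IH.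
Qed.

(** * The squared modulus of the packet has integral one *)

Section normalization.
Variables (R : realType) (d : nat) (eps : R) (C : 'M[R[i]]_d).
Hypotheses (heps : 0 < eps) (hC : siegel C).
Local Notation lam := (lebesgue_tuple R d).
Local Notation col := (@col_of_tuple R d).
Local Notation amp := (gauss_amp eps C).
Let B : 'M[R]_d := map_mx (@complex.Im R) C.

Lemma symB : B^T = B.
Proof. by rewrite /B map_trmx; case: hC => ->. Qed.

Lemma sym_scaled : (eps^-1 *: B)^T = eps^-1 *: B.
Proof. by rewrite linearZ /= symB. Qed.

Lemma posdef_scaled : posdef (eps^-1 *: B).
Proof.
move=> v v0; rewrite -scalemxAr -scalemxAl mxE mulr_gt0 ?invr_gt0//.
by case: hC => _; exact.
Qed.

Lemma qform_scaled z : qform (eps^-1 *: B) z = eps^-1 * qform B z.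
Proof. by rewrite /qform -scalemxAr -scalemxAl mxE. Qed.

Lemma det_B_gt0 : 0 < \det B.
Proof. by have [] := integral_gauss_qform symB (proj2 hC). Qed.

Lemma amp_sqr z : amp z ^+ 2 = gauss_peak eps C ^+ 2 * expR (- qform (eps^-1 *: B) z).
Proof.
rewrite /gauss_amp exprMn -expRM_natl qform_scaled; congr (_ * expR _).
by rewrite -/B; field; rewrite lt0r_neq0.
Qed.

Lemma gauss_peak_gt0 : 0 < gauss_peak eps C.
Proof. by rewrite mulr_gt0// powR_gt0 ?det_B_gt0// mulr_gt0 ?pi_gt0. Qed.

(** Squaring turns the exponents - d / 4 and 1 / 4 into - d / 2 and 1 / 2, while det (eps^-1 B) =
    eps^-d det B; all powers of pi, eps and det B cancel. *)
Lemma gauss_peak_sqr : gauss_peak eps C ^+ 2 *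
  (Num.sqrt pi ^+ d / Num.sqrt (\det (eps^-1 *: B))) = 1.
Proof.
have pe0 : 0 < pi * eps by rewrite mulr_gt0 ?pi_gt0.
have dB := det_B_gt0.
have h4 : (\det B `^ (1 / 4)) ^+ 2 = Num.sqrt (\det B).
  rewrite -powR_mulrn ?powR_ge0// -powRrM -powR12_sqrt ?ltW//; congr powR; lra.
have h5 : ((pi * eps) `^ (- (d%:R / 4))) ^+ 2 = (Num.sqrt (pi * eps) ^+ d)^-1.
  rewrite -powR_mulrn ?powR_ge0// -powRrM -powR12_sqrt ?ltW//.
  rewrite -powR_mulrn ?powR_ge0// -powRrM -powRN; congr powR; lra.
rewrite /gauss_peak -/B exprMn h4 h5 detZ (sqrtrM eps) ?pi_ge0// exprMn.
rewrite (sqrtrM (\det B)) ?exprn_ge0 ?invr_ge0 ?(ltW heps)//.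
have -> : Num.sqrt (eps^-1 ^+ d) = (Num.sqrt eps ^+ d)^-1.
  by rewrite -exprVn -sqrtrV ?(ltW heps)// sqrtr_expr// invr_ge0 ltW.
have s1 : Num.sqrt pi ^+ d != 0 :> R by rewrite expf_neq0// lt0r_neq0// sqrtr_gt0 pi_gt0.
have s2 : Num.sqrt eps ^+ d != 0 by rewrite expf_neq0// lt0r_neq0// sqrtr_gt0.
have s3 : Num.sqrt (\det B) != 0 by rewrite lt0r_neq0// sqrtr_gt0.
by field; rewrite s1 s2 s3.
Qed.

Lemma integrable_gauss_qform : lam.-integrable setT
  (fun t => (expR (- qform (eps^-1 *: B) (col t)))%:E).
Proof.
apply/integrableP; split.
  apply/measurable_EFinP.
  apply: (measurable_col (f := fun v => expR (- qform (eps^-1 *: B) v))).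
  apply: (continuous_compR (h := expR)); first exact: continuous_expR.
  apply: (continuous_compR (h := fun r => - r)); last exact: continuous_qform.
  by move=> r; apply: cvgN; exact: cvg_id.
under eq_integral do rewrite gee0_abs ?lee_fin ?expR_ge0//.
by rewrite (integral_gauss_qform sym_scaled posdef_scaled).2 ltry.
Qed.

Lemma qformN n (A : 'M[R]_n) z : qform A (- z) = qform A z.
Proof.
have -> : qform A (- z) = ((- z)^T *m A *m (- z)) 0 0 by [].
have -> : (- z)^T = - z^T by apply/matrixP => i j; rewrite !mxE.
by rewrite mulmxN !mulNmx opprK.
Qed.

(** The integration variable is the centre of the packet; evenness of the form makes the integrand a
    Gaussian centred at [x]. *)
Lemma amp_sqr_flip x y : amp (x - y) ^+ 2 =
  gauss_peak eps C ^+ 2 * expR (- qform (eps^-1 *: B) (y - x)).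
Proof. by rewrite amp_sqr -[x - y]opprB qformN. Qed.

Lemma integrable_gauss_shift x : lam.-integrable setT
  (EFin \o (fun t => expR (- qform (eps^-1 *: B) (col t - x)))).
Proof.
have := integrable_affine (fun i => - x i 0) ltr01 integrable_gauss_qform.
apply: eq_integrable => // t _ /=; rewrite col_affine scale1r addrC.
by congr (expR (- qform _ (_ + _)))%:E; apply/colP => i; rewrite !mxE.
Qed.

Lemma integrable_amp_sqr x : lam.-integrable setT
  (fun t => (amp (x - col t) ^+ 2)%:E).
Proof.
under eq_fun do rewrite amp_sqr_flip EFinM.
exact: (integrableZl measurableT _ (integrable_gauss_shift x)).
Qed.

Lemma Rintegral_amp_sqr x : \int[lam]_t (amp (x - col t) ^+ 2) = 1.
Proof.
have ig := integrable_gauss_qform.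
under eq_Rintegral do rewrite amp_sqr_flip.
rewrite (RintegralZl _ measurableT (integrable_gauss_shift x)).
rewrite (Rintegral_shift (u := fun v => expR (- qform (eps^-1 *: B) v)) (- x))//.
rewrite /Rintegral (integral_gauss_qform sym_scaled posdef_scaled).2.
exact: gauss_peak_sqr.
Qed.

Lemma modc_gaussian z : modc (gaussian eps C 0 0 z) ^+ 2 = amp z ^+ 2.
Proof.
rewrite gaussianE subr0 scaler0 /modc /= sqr_sqrtr ?addr_ge0 ?sqr_ge0//.
by rewrite !exprMn -mulrDr cos2Dsin2 mulr1.
Qed.

End normalization.

Unset Implicit Arguments.
Set Strict Implicit.
Set Printing Implicit Defensive.

Theorem proposition2p3 (R : realType) (d : nat) (eps : R) (C : 'M[R[i]]_d)
    (Gamma : set 'cV[int]_d) (qs : 'cV[int]_d -> 'cV[R]_d)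
    (psi : 'cV[R]_d -> R[i])
    (hd : (0 < d)%N) (heps : 0 < eps) (hC : siegel C) (hGamma : Gamma !=set0)
    (hS : forall x : 'cV[R]_d, (grid_sum eps C Gamma qs x < +oo)%E)
    (hpsi : schwartz psi) :
  (forall q p : 'cV[R]_d,
     cintegrable (fun x => conjc (gaussian eps C q p x) * psi x)) /\
  (forall q x : 'cV[R]_d, cintegrable (momentum_integrand eps C psi q x)) /\
  forall x : 'cV[R]_d,
    (csummable Gamma (fun k => momentum_integral eps C psi (qs k) x) /\
     psi x = real_complex R (1 / fine (grid_sum eps C Gamma qs x)) *
             csum Gamma (fun k => momentum_integral eps C psi (qs k) x)) /\
    (cintegrable (fun q => momentum_integral eps C psi q x) /\
     psi x = cintegral (fun q => momentum_integral eps C psi q x)).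
Proof.
split; first by move=> q p; exact: cintegrable_inner.
split; first by move=> q x; exact: cintegrable_momentum.
move=> x.
pose a k := gauss_amp eps C (x - qs k) ^+ 2.
have a0 k : 0 <= a k by exact: sqr_ge0.
have SE : grid_sum eps C Gamma qs x = (\esum_(k in Gamma) (a k)%:E)%E.
  by apply: eq_esum => k _; rewrite modc_gaussian.
have aoo : (\esum_(k in Gamma) (a k)%:E < +oo)%E by rewrite -SE.
(* A single index of the non-empty set [Gamma] already contributes a positive term, so dividing by
   S(x) is legitimate. *)
have S0 : 0 < fine (grid_sum eps C Gamma qs x).
  rewrite SE fine_gt0// aoo andbT; case: hGamma => k0 Gk0.
  apply: (@lt_le_trans _ _ (a k0)%:E).
    by rewrite lte_fin exprn_gt0// mulr_gt0 ?expR_gt0// gauss_peak_gt0.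
  apply: esum_ge; exists [set k0]; first by split; [exact: finite_set1|move=> _ ->].
  by rewrite fsbig_set1.
(* Both parts are the same nonnegative factor times a constant in [q], so the grid sum and the
   integral over [q] reduce to those of the factor alone. *)
have mE q : momentum_integral eps C psi q x =
    Complex (gauss_amp eps C (x - q) ^+ 2 * complex.Re (psi x))
            (gauss_amp eps C (x - q) ^+ 2 * complex.Im (psi x)).
  rewrite momentum_integralE//; apply: complexP; rewrite ?ReM ?ImM /=; ring.
split; split.
- rewrite /csummable.
  under eq_esum do rewrite momentum_integralE// /modc ComplexField.Normc.normcM
    -/(modc _) modc_real ger0_norm ?sqr_ge0// mulrC.
  have m0 : 0 <= modc (psi x) by case: (psi x) => r s; exact: sqrtr_ge0.
  by rewrite (esumZ Gamma a0 m0) lte_mul_pinfty// lee_fin.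
- have -> : csum Gamma (fun k => momentum_integral eps C psi (qs k) x) =
      Complex (fine (grid_sum eps C Gamma qs x) * complex.Re (psi x))
              (fine (grid_sum eps C Gamma qs x) * complex.Im (psi x)).
    rewrite SE -!rsumZ// /csum.
    by congr Complex; congr rsum; apply/funext => k; rewrite mE.
  have Sn := lt0r_neq0 S0.
  by apply: complexP; rewrite ?ReM ?ImM /=; field.
- split.
  + under eq_fun do rewrite mE /= EFinM muleC.
    by apply: integrableZl => //; exact: integrable_amp_sqr.
  + under eq_fun do rewrite mE /= EFinM muleC.
    by apply: integrableZl => //; exact: integrable_amp_sqr.
- have iA := integrable_amp_sqr heps hC x.
  have -> : cintegral (fun q => momentum_integral eps C psi q x) = Complex
      (\int[lebesgue_tuple R d]_t
        (gauss_amp eps C (x - col_of_tuple t) ^+ 2 * complex.Re (psi x)))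
      (\int[lebesgue_tuple R d]_t
        (gauss_amp eps C (x - col_of_tuple t) ^+ 2 * complex.Im (psi x))).
    by congr Complex; apply: eq_Rintegral => t _; rewrite mE.
  rewrite !(RintegralZr _ measurableT iA) Rintegral_amp_sqr// !mul1r.
  by case: (psi x).
Qed.
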